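(* Let $d\ge2$, $q\in[1,\infty)$, and let $\mathcal X$ and $\mathcal Y$ be compact and convex subsets of $\mathbb R^d$. Let $M>0$, $\theta\in(0,1]$, and let $\rho_0$ be a probability measure on $\mathcal X$ satisfying $\rho_0(B_\eta(x))\le M\eta^{d-1+\theta}$ for every $x\in\mathbb R^d$ and $\eta>0$. Let $\mu_0\in\mathcal P(\mathcal Y)$, and denote by $\gamma_0$ the unique optimal plan between $\rho_0$ and $\mu_0$. Then for any $\rho_1\in\mathcal P(\mathcal X)$, $\mu_1\in\mathcal P(\mathcal Y)$ and any plan $\gamma_1\in\Pi(\rho_1,\mu_1)$, $$W_q(\gamma_0,\gamma_1)\le C\left(\left|\int_{\mathcal X\times\mathcal Y}\langle x,y\rangle\,d(\gamma_0-\gamma_1)\right|+R_{\mathcal Y}W_1(\rho_0,\rho_1)+R_{\mathcal X}W_1(\mu_0,\mu_1)\right)^{\frac{\theta}{q(1+\theta)}},$$ where $$C^q=D_{\mathcal X}^{\,q-1+\frac1{1+\theta}}R_{\mathcal Y}^{-\frac{\theta}{1+\theta}}+D_{\mathcal Y}^{\,q}\left(1+c_dMR_{\mathcal X}^{d-1+\theta}\right)(D_{\mathcal Y}R_{\mathcal X})^{-\frac{\theta}{1+\theta}}.$$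
   Context: $\mathcal P(E)$ is the set of Borel probability measures on $E$, and $B_\eta(x)$ is the open Euclidean ball. $R_{\mathcal X}=\sup_{x\in\mathcal X}\|x\|$, $R_{\mathcal Y}=\sup_{y\in\mathcal Y}\|y\|$, $D_{\mathcal X}=\operatorname{diam}(\mathcal X)$, $D_{\mathcal Y}=\operatorname{diam}(\mathcal Y)$. $\beta_k$ is the volume of the unit ball of $\mathbb R^k$ and $c_d=\frac43\,\frac{6^d d^2(d+1)\beta_d}{\beta_{d-1}}$. The constant $C$ is read as $+\infty$ (nothing is asserted) if $R_{\mathcal Y}=0$; if $D_{\mathcal Y}=0<R_{\mathcal Y}$ the second summand of $C^q$ is read as $0$. $\Pi(\rho,\mu)$ is the set of couplings (transport plans) of $\rho$ and $\mu$. Optimal plans are the minimisers of $\int\|x-y\|^2\,d\gamma(x,y)$ over $\gamma\in\Pi(\rho,\mu)$; under the stated condition on $\rho_0$ the optimal plan is unique (Brenier-McCann). $W_1(\rho,\mu)=\min_{\gamma\in\Pi(\rho,\mu)}\int\|x-y\|\,d\gamma$ on $\mathbb R^d$. For probability measures $\gamma_0,\gamma_1$ on $\mathbb R^d\times\mathbb R^d$, $W_q^q(\gamma_0,\gamma_1)=\inf_{\pi\in\Pi(\gamma_0,\gamma_1)}\int\|x_0-x_1\|^q+\|y_0-y_1\|^q\,d\pi(x_0,y_0,x_1,y_1)$. *)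

(* Defs.v *)
From HB Require Import structures.
From mathcomp Require Import all_boot all_order all_algebra.
From mathcomp Require Import all_classical all_reals all_analysis.

Set Implicit Arguments.
Unset Strict Implicit.
Unset Printing Implicit Defensive.

Import Order.TTheory GRing.Theory Num.Theory.
Import numFieldNormedType.Exports.

Local Open Scope classical_set_scope.
Local Open Scope ring_scope.

(* Row vectors carry the Borel sigma-algebra. The library topology on matrices
   comes from the sup norm; it is the Euclidean topology. *)
HB.instance Definition _ (R : realType) (m n : nat) :=
  @isMeasurable.Build (sigma_display (@open 'M[R]_(m, n))) 'M[R]_(m, n)
    <<s @open 'M[R]_(m, n) >> (@sigma_algebra0 _ setT _) (@sigma_algebraC _ _)
    (@sigma_algebra_bigcup _ setT _).

Section euclidean.
Context {R : realType} {n : nat}.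
Implicit Types (x y : 'rV[R]_n) (A : set 'rV[R]_n).

Definition dotp x y : R := \sum_(i < n) x ord0 i * y ord0 i.

(* `|x| is the sup norm on 'rV[R]_n, so the Euclidean norm needs its own name. *)
Definition enorm x : R := Num.sqrt (dotp x x).

Definition eball x (r : R) : set 'rV[R]_n := [set y | enorm (y - x) < r].

Definition set_radius A : R := sup [set enorm x | x in A].

Definition set_diam A : R := sup [set enorm (x - y) | x in A & y in A].

End euclidean.

(* The n-fold product of the Lebesgue measure of R, by iterated integration over
   sections as in product_measure1. It is used on Borel sets only. *)
Fixpoint lebesgue_rV (R : realType) (n : nat) : set 'rV[R]_n -> \bar R :=
  match n with
  | 0%N => fun A => \d_(0 : 'rV[R]_0) A
  | k.+1 => fun A => (\int[@lebesgue_measure R]_t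
      lebesgue_rV [set v : 'rV[R]_k | A (row_mx (t%:M : 'rV[R]_1) v)])%E
  end.

Definition unit_ball_volume (R : realType) (k : nat) : R :=
  fine (lebesgue_rV (eball (0 : 'rV[R]_k) 1)).

Definition c_dim (R : realType) (d : nat) : R :=
  4 / 3 * (6 ^+ d * d%:R ^+ 2 * (d%:R + 1) * unit_ball_volume R d
           / unit_ball_volume R d.-1).

Section transport.
Context {R : realType}.

Definition coupling d1 d2 (T1 : measurableType d1) (T2 : measurableType d2)
    (P : probability T1 R) (Q : probability T2 R) :
    set (probability (T1 * T2)%type R) :=
  [set g | (forall A, measurable A -> pushforward g fst A = P A) /\
           (forall B, measurable B -> pushforward g snd B = Q B)].

Context {n : nat}.
Local Notation V := 'rV[R]_n.

Definition quadratic_cost (g : probability (V * V)%type R) : \bar R :=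
  (\int[g]_z ((enorm (z.1 - z.2) ^+ 2)%:E))%E.

Definition optimal_plan (rho mu : probability V R) :
    set (probability (V * V)%type R) :=
  [set g | coupling rho mu g /\
    forall g', coupling rho mu g' -> (quadratic_cost g <= quadratic_cost g')%E].

Definition wass1 (rho mu : probability V R) : \bar R :=
  ereal_inf [set (\int[g]_z ((enorm (z.1 - z.2))%:E))%E | g in coupling rho mu].

Definition wass_plan (q : R) (g0 g1 : probability (V * V)%type R) : \bar R :=
  poweR (ereal_inf
    [set (\int[p]_z ((enorm (z.1.1 - z.2.1) `^ q
                      + enorm (z.1.2 - z.2.2) `^ q)%:E))%E
      | p in coupling g0 g1]) q^-1.

(* The q-th power of the constant. As 0 `^ q = 0 for q > 0, the second summand
   vanishes when Y is a single point. *)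
Definition constq (q M theta : R) (X Y : set V) : R :=
  set_diam X `^ (q - 1 + (1 + theta)^-1) * set_radius Y `^ (- (theta / (1 + theta)))
  + set_diam Y `^ q
    * (1 + c_dim R n * M * set_radius X `^ (n%:R - 1 + theta))
    * (set_diam Y * set_radius X) `^ (- (theta / (1 + theta))).

End transport.

(* Main.v *)
From HB Require Import structures.
Require Import Defs.
From mathcomp Require Import all_boot all_order all_algebra.
From mathcomp Require Import all_classical all_reals all_analysis.
From mathcomp Require Import measurable_realfun.
From mathcomp Require Import ring lra zify.
Import Order.TTheory GRing.Theory Num.Theory.
Import numFieldNormedType.Exports.
Local Open Scope classical_set_scope.
Local Open Scope ring_scope.

(** Let [phi] and [psi] be dual potentials of the optimal plan, so that the
    gap [phi x + psi y - dotp x y] is nonnegative and its integral against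
    [gamma0] is zero. Couple [gamma0] and [gamma1] in such a way that the
    first coordinates [x0] and [x1] are coupled optimally. This takes care
    of the distance between [x0] and [x1]. As [psi] and the scalar product
    are Lipschitz, the gap of the mixed pair [(x0, y1)] integrates to at
    most the quantity [eps] that is raised to a power in the conclusion. So
    [y0] is a subgradient of the convex function [phi] at [x0], and [y1] is
    an approximate one, with a known mean error. At a scale [eta], the
    distance of [y0] and [y1] is at most the error divided by [eta], plus
    the oscillation of the gradient of [phi] near [x0], measured by a second
    difference of [phi] with step [eta] divided by [eta] ([gap_le_diff2]).

    The gradient of [phi] takes values in [Y], and a gradient of a convex
    function has bounded variation: its oscillation at scale [eta] exceeds a
    given size on few balls only. In [diff2_covering] the second difference
    is dominated by indicators of balls of radius [eta / 2] whose total
    weight is of order [(RX / eta) ^ (d - 1)] times [eta] and the diameter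
    of [Y]. The proof moves the second difference to nearby points
    ([diff2_le_sum]), averages over a fine lattice, and uses that second
    differences telescope along lines ([sum_diff2_line]). Numbers of lattice
    points play the role of volumes. Since [rho0] gives a ball of radius
    [eta] mass at most [M * eta ^ (d - 1 + theta)], the mean oscillation is
    of order [eta ^ theta] ([gap_estimate]). Balancing the two terms in
    [eta] gives the exponent and the constant ([optimize_scale]).

    Exact potentials and exact gluings are replaced by approximate ones,
    with an error that tends to zero at the end ([powR_le_limit]). Both come
    from one construction, [block_coupling]: given finite partitions of two
    probability spaces, any matrix with the right marginals is the matrix of
    cell masses of a coupling. It yields approximate gluings without
    disintegration ([approximate_gluing]), and it shows that a discretized
    optimal plan is almost optimal among finite plans. So Kantorovich
    duality is only needed for finite plans ([finite_duality]), where it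
    follows from Rockafellar's construction; the potentials then extend to
    [approximate_duality].

    The volumes of balls enter through [c_dim] alone, and only a lower bound
    for the ratio of two consecutive ones is needed
    ([unit_ball_volume_ratio]). *)

Set Implicit Arguments.
Unset Strict Implicit.
Unset Printing Implicit Defensive.

(** * Euclidean norm *)

Section euclid.
Context {R : realType} {n : nat}.
Implicit Types (x y z : 'rV[R]_n) (a : R).

Lemma dotpC x y : dotp x y = dotp y x.
Proof. by apply: eq_bigr => i _; rewrite mulrC. Qed.

Lemma dotpDl x y z : dotp (x + y) z = dotp x z + dotp y z.
Proof.
by rewrite /dotp -big_split; apply: eq_bigr => i _; rewrite mxE mulrDl.
Qed.

Lemma dotpZl a x y : dotp (a *: x) y = a * dotp x y.
Proof.
by rewrite /dotp mulr_sumr; apply: eq_bigr => i _; rewrite mxE mulrA.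
Qed.

Lemma dotpNl x y : dotp (- x) y = - dotp x y.
Proof. by rewrite -scaleN1r dotpZl mulN1r. Qed.

Lemma dotpBl x y z : dotp (x - y) z = dotp x z - dotp y z.
Proof. by rewrite dotpDl dotpNl. Qed.

Lemma dotpDr x y z : dotp z (x + y) = dotp z x + dotp z y.
Proof. by rewrite dotpC dotpDl !(dotpC z). Qed.

Lemma dotpZr a x y : dotp x (a *: y) = a * dotp x y.
Proof. by rewrite dotpC dotpZl dotpC. Qed.

Lemma dotpNr x y : dotp x (- y) = - dotp x y.
Proof. by rewrite dotpC dotpNl dotpC. Qed.

Lemma dotpBr x y z : dotp z (x - y) = dotp z x - dotp z y.
Proof. by rewrite dotpDr dotpNr. Qed.

Lemma dotp_delta x j : dotp (delta_mx ord0 j) x = x ord0 j.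
Proof.
rewrite /dotp (bigD1 j)//= big1 ?addr0 ?mxE ?eqxx ?mul1r// => i ij.
by rewrite mxE (negbTE ij) mul0r.
Qed.

Lemma dotp_ge0 x : 0 <= dotp x x.
Proof. by apply: sumr_ge0 => i _; rewrite -expr2 sqr_ge0. Qed.

Lemma enorm_ge0 x : 0 <= enorm x.
Proof. exact: sqrtr_ge0. Qed.

Lemma enorm_sqr x : enorm x ^+ 2 = dotp x x.
Proof. by rewrite sqr_sqrtr ?dotp_ge0. Qed.

Lemma enormZ a x : enorm (a *: x) = `|a| * enorm x.
Proof.
by rewrite /enorm dotpZl dotpZr mulrA -expr2 sqrtrM ?sqr_ge0// sqrtr_sqr.
Qed.

Lemma enormN x : enorm (- x) = enorm x.
Proof. by rewrite -scaleN1r enormZ normrN1 mul1r. Qed.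

Lemma enorm0 : enorm (0 : 'rV[R]_n) = 0.
Proof. by rewrite -(scale0r 0) enormZ normr0 mul0r. Qed.

Lemma enormB x y : enorm (x - y) = enorm (y - x).
Proof. by rewrite -enormN opprB. Qed.

Lemma enorm_coord x j : `|x ord0 j| <= enorm x.
Proof.
rewrite -sqrtr_sqr ler_wsqrtr// /dotp (bigD1 j)//= expr2 lerDl.
by apply: sumr_ge0 => i _; rewrite -expr2 sqr_ge0.
Qed.

Lemma enorm_eq0 x : enorm x = 0 -> x = 0.
Proof.
move=> x0; apply/rowP => j; rewrite mxE; apply/normr0_eq0.
by apply/eqP; rewrite eq_le normr_ge0 andbT -x0 enorm_coord.
Qed.

Lemma cauchy_schwarz x y : dotp x y <= enorm x * enorm y.
Proof.
have [->|y0] := eqVneq y 0.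
  by rewrite enorm0 mulr0 -(scale0r 0) dotpZr mul0r.
have ny : 0 < enorm y.
  by rewrite lt_neqAle enorm_ge0 andbT eq_sym; apply: contraNneq y0 => /enorm_eq0 ->.
apply: (@le_trans _ _ `|dotp x y|); first exact: ler_norm.
rewrite -(@ler_pXn2r _ 2) ?nnegrE ?mulr_ge0 ?enorm_ge0//.
rewrite exprMn !enorm_sqr real_normK ?num_real//.
have := dotp_ge0 (dotp y y *: x - dotp x y *: y).
rewrite dotpBl !dotpBr !dotpZl !dotpZr (dotpC y x).
have y2 : 0 < dotp y y by rewrite -enorm_sqr exprn_gt0.
set a := dotp y y in y2 *; set b := dotp x y; set c := dotp x x => H.
have : 0 <= a * (c * a - b ^+ 2) by move: H; congr (0 <= _); ring.
by rewrite pmulr_rge0// subr_ge0.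
Qed.

Lemma norm_dotp_le x y : `|dotp x y| <= enorm x * enorm y.
Proof.
rewrite ler_norml cauchy_schwarz andbT lerNl -dotpNl -(enormN x).
exact: cauchy_schwarz.
Qed.

Lemma enorm_triangle x y : enorm (x + y) <= enorm x + enorm y.
Proof.
rewrite -(@ler_pXn2r _ 2) ?nnegrE ?addr_ge0 ?enorm_ge0//.
rewrite sqrrD !enorm_sqr dotpDl !dotpDr (dotpC y x).
have := cauchy_schwarz x y; rewrite mulr2n; lra.
Qed.

Lemma enorm_distD z x y : enorm (x - y) <= enorm (x - z) + enorm (z - y).
Proof. by apply: le_trans (enorm_triangle _ _); rewrite addrA subrK. Qed.

Lemma enorm_dist_le x y : `|enorm x - enorm y| <= enorm (x - y).
Proof.
rewrite ler_norml; apply/andP; split.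
  have := enorm_triangle x (y - x); rewrite addrC subrK (enormB y x); lra.
have := enorm_triangle (x - y) y; rewrite subrK; lra.
Qed.

Lemma enorm_le_sup x a : 0 <= a -> (forall j, `|x ord0 j| <= a) ->
  enorm x <= Num.sqrt n%:R * a.
Proof.
move=> a0 xa; rewrite -(@ler_pXn2r _ 2) ?nnegrE ?mulr_ge0 ?enorm_ge0 ?sqrtr_ge0//.
rewrite enorm_sqr exprMn sqr_sqrtr ?ler0n// /dotp.
apply: (@le_trans _ _ (\sum_(i < n) a ^+ 2)).
  apply: ler_sum => i _; rewrite -expr2 -[leLHS]real_normK ?num_real//.
  by rewrite ler_pXn2r ?nnegrE.
by rewrite sumr_const card_ord mulr_natl lexx.
Qed.

Lemma norm1_le_enorm x : \sum_j `|x ord0 j| <= Num.sqrt n%:R * enorm x.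
Proof.
pose s : 'rV[R]_n := \row_j Num.sg (x ord0 j).
have -> : \sum_j `|x ord0 j| = dotp x s.
  by apply: eq_bigr => j _; rewrite mxE normrEsg mulrC.
apply: (le_trans (cauchy_schwarz _ _)); rewrite mulrC ler_wpM2r ?enorm_ge0//.
rewrite -[leRHS]mulr1; apply: enorm_le_sup => // j; rewrite mxE normr_sg.
by case: (x ord0 j == 0); rewrite /= ?ler01.
Qed.

End euclid.

Lemma enorm_le_coord (R : realType) n (x y : 'rV[R]_n) :
  (forall j, `|x ord0 j| <= `|y ord0 j|) -> enorm x <= enorm y.
Proof.
move=> xy; rewrite ler_wsqrtr// /dotp; apply: ler_sum => j _.
rewrite -!expr2 -[leLHS]real_normK ?num_real// -[leRHS]real_normK ?num_real//.
by rewrite ler_pXn2r ?nnegrE.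
Qed.

(** * Second differences of convex functions *)

Section second_difference.
Context {R : realType} {n : nat}.
Local Notation V := 'rV[R]_n.
Implicit Types (f : V -> R) (x y z v : V).

Definition is_cvx f := forall x y (t : R), 0 <= t <= 1 ->
  f (t *: x + (1 - t) *: y) <= t * f x + (1 - t) * f y.

Definition diff2 f v x := f (x + v) + f (x - v) - 2 * f x.

(** Jensen's inequality for weights of total mass at most [t]: the missing
    mass sits at 0, where [f] vanishes. The form multiplied by [t] suits the
    induction: removing a term lowers [t] by its weight. *)
Lemma jensen f (I : Type) (r : seq I) (w : I -> R) (p : I -> V) (t : R) :
  is_cvx f -> f 0 = 0 -> (forall i, 0 <= w i) -> 0 < t ->
  \sum_(i <- r) w i <= t ->
  t * f (t^-1 *: \sum_(i <- r) w i *: p i) <= \sum_(i <- r) w i * f (p i).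
Proof.
move=> cf f0 w0; elim: r t => [|i r IH] t t0.
  by rewrite !big_nil scaler0 f0 mulr0.
rewrite !big_cons => wt.
have S0 : 0 <= \sum_(i <- r) w i by apply: sumr_ge0.
have [tw|tw] := eqVneq t (w i).
  have Sr : \sum_(i <- r) w i = 0 by lra.
  have wr : forall (q : seq I), \sum_(i <- q) w i = 0 ->
      \sum_(j <- q) w j *: p j = 0 /\ \sum_(j <- q) w j * f (p j) = 0.
    elim=> [|j q IHq]; first by rewrite !big_nil.
    rewrite !big_cons => wq.
    have : 0 <= \sum_(i <- q) w i by apply: sumr_ge0.
    move: (w0 j) => wj0 wq0; have wj : w j = 0 by lra.
    have [|-> ->] := IHq; first lra.
    by rewrite wj scale0r mul0r !addr0.
  have [-> ->] := wr r Sr.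
  by rewrite !addr0 scalerA tw mulVf ?scale1r// -tw gt_eqF.
have u0 : 0 < t - w i by move: tw; rewrite neq_lt; move: S0 => ? /orP[]; lra.
have := IH (t - w i) u0; set s := \sum_(j <- r) w j *: p j.
set e := \sum_(j <- r) w j * f (p j) => {}IH.
have {}IH : (t - w i) * f ((t - w i)^-1 *: s) <= e by apply: IH; lra.
have -> : t^-1 *: (w i *: p i + s) =
    (w i / t) *: p i + (1 - w i / t) *: ((t - w i)^-1 *: s).
  rewrite scalerDr !scalerA [t^-1 * _]mulrC; congr (_ + _ *: _).
  by field; rewrite !gt_eqF.
have := cf (p i) ((t - w i)^-1 *: s) (w i / t).
have -> : 0 <= w i / t <= 1.
  apply/andP; split; first by apply: divr_ge0 => //; exact: ltW.
  by rewrite ler_pdivrMr// mul1r; lra.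
move=> /(_ isT); rewrite -(ler_pM2l t0) => /le_trans; apply.
have -> : t * (w i / t * f (p i) + (1 - w i / t) * f ((t - w i)^-1 *: s)) =
  w i * f (p i) + (t - w i) * f ((t - w i)^-1 *: s) by field; rewrite gt_eqF.
by rewrite lerD2l.
Qed.

Lemma diff2N f v x : diff2 f (- v) x = diff2 f v x.
Proof. by rewrite /diff2 opprK [f (x - v) + _]addrC. Qed.

Lemma diff2_cvx f x : is_cvx f -> is_cvx (fun v => diff2 f v x).
Proof.
move=> cf v w t t01; rewrite /diff2.
have := cf (x + v) (x + w) t t01; have := cf (x - v) (x - w) t t01.
have -> : t *: (x - v) + (1 - t) *: (x - w) = x - (t *: v + (1 - t) *: w).
  rewrite !scalerBr opprD addrACA -scalerDl (_ : t + (1 - t) = 1) ?scale1r//.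
  by ring.
have -> : t *: (x + v) + (1 - t) *: (x + w) = x + (t *: v + (1 - t) *: w).
  rewrite !scalerDr addrACA -scalerDl (_ : t + (1 - t) = 1) ?scale1r//.
  by ring.
lra.
Qed.

Lemma diff2_ge0 f v x : is_cvx f -> 0 <= diff2 f v x.
Proof.
move=> cf; rewrite /diff2.
have := cf (x + v) (x - v) 2^-1; have -> : 0 <= (2^-1 : R) <= 1 by lra.
have -> : 2^-1 *: (x + v) + (1 - 2^-1) *: (x - v) = x.
  by apply/rowP => j; rewrite !mxE; field.
move=> /(_ isT); lra.
Qed.

Local Notation e_ j := (delta_mx ord0 j : V).

(** The second difference is a convex even function of its step that
    vanishes at 0, and [v] is a mean of 0 and of signed multiples [r] of the
    basis vectors. *)
Lemma diff2_le_coord f v x (r B : R) : is_cvx f -> 0 < r ->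
  \sum_j `|v ord0 j| <= r ->
  (forall j, diff2 f (r *: e_ j) x <= B) ->
  diff2 f v x <= (\sum_j `|v ord0 j|) / r * B.
Proof.
move=> cf r0 vr HB.
have d0 : diff2 f 0 x = 0 by rewrite /diff2 subr0 addr0; ring.
have := @jensen _ _ (index_enum 'I_n) (fun j => `|v ord0 j|)
  (fun j => (r * Num.sg (v ord0 j)) *: e_ j) r (diff2_cvx x cf) d0
  (fun j => normr_ge0 _) r0 vr.
have -> : r^-1 *: \sum_j `|v ord0 j| *: ((r * Num.sg (v ord0 j)) *: e_ j) = v.
  rewrite {3}[v]row_sum_delta scaler_sumr; apply: eq_bigr => j _.
  rewrite !scalerA; congr (_ *: _).
  rewrite [RHS]numEsg; field; exact: lt0r_neq0.
rewrite -ler_pdivlMl// => /le_trans; apply.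
rewrite mulrC mulrAC ler_pM2r ?invr_gt0// mulr_suml; apply: ler_sum => j _.
rewrite ler_wpM2l//; apply: le_trans (HB j).
rewrite le_eqVlt; have [||] := sgrP (v ord0 j); rewrite ?mulr0 ?mulr1 ?eqxx//.
  by rewrite scale0r d0 => _; rewrite -le_eqVlt diff2_ge0.
by rewrite mulrN1 scaleNr diff2N eqxx.
Qed.

(** The points [x + v] and [x - v] are the midpoints of [z + 2 v],
    respectively [z - 2 v], and of the reflection of [z] through [x]. So
    convexity moves a second difference from [x] to a point [z] nearby, at
    the price of a doubled step. *)
Lemma diff2_double f v x z : is_cvx f ->
  2 * diff2 f v x - 2 * diff2 f (z - x) x <= diff2 f (2 *: v) z.
Proof.
move=> cf; rewrite /diff2.
have half a b : f (2^-1 *: (a + b)) <= (f a + f b) / 2.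
  have := cf a b 2^-1; have -> : 0 <= (2^-1 : R) <= 1 by lra.
  rewrite (_ : 1 - 2^-1 = 2^-1 :> R); last by field.
  by rewrite -scalerDr => /(_ isT); lra.
have E (c : V) : 2^-1 *: (2 *: c) = c by rewrite scalerA mulVf ?scale1r.
have E2 (c : V) : 2 *: c = c + c by rewrite scaler_nat mulr2n.
have := half (z + 2 *: v) (x - (z - x)).
have -> : z + 2 *: v + (x - (z - x)) = 2 *: (x + v).
  by rewrite !E2; apply/rowP => j; rewrite !mxE; ring.
rewrite E.
have := half (z - 2 *: v) (x - (z - x)).
have -> : z - 2 *: v + (x - (z - x)) = 2 *: (x - v).
  by rewrite !E2; apply/rowP => j; rewrite !mxE; ring.
rewrite E [x + (z - x)]addrC subrK; lra.
Qed.

(** This removes the base point [x] and the direction [v] from the left-hand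
    side: any [z] close enough to [x] may serve, so the bound can be
    averaged over [z]. Only the largest coordinate second difference at [x]
    needs to be moved to [z], by [diff2_double], because it also controls
    the loss term there. *)
Lemma diff2_le_sum f v x z (r : R) : is_cvx f -> 0 < r ->
  \sum_j `|v ord0 j| <= r -> \sum_j `|(z - x) ord0 j| <= r / 2 ->
  diff2 f v x <= \sum_j diff2 f ((2 * r) *: e_ j) z.
Proof.
move=> cf r0 vr zr.
have S0 : 0 <= \sum_j diff2 f ((2 * r) *: e_ j) z.
  by apply: sumr_ge0 => j _; exact: diff2_ge0.
have [[j0 _]|no] := pselect (exists j : 'I_n, True); last first.
  have -> : v = 0 by apply/rowP => j; case: no; exists j.
  by rewrite /diff2 subr0 addr0; lra.
pose g j := diff2 f (r *: e_ j) x.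
have [j _ Hj] := @arg_maxP _ R 'I_n j0 xpredT g isT.
have gj : forall i, diff2 f (r *: e_ i) x <= g j by move=> i; exact: Hj.
have gj0 : 0 <= g j by exact: diff2_ge0.
have zr' : \sum_j `|(z - x) ord0 j| <= r by lra.
have h1 := diff2_le_coord cf r0 vr gj.
have h2 := diff2_le_coord cf r0 zr' gj.
have h3 := diff2_double (r *: e_ j) x z cf.
rewrite scalerA in h3.
have h1' : (\sum_j `|v ord0 j|) / r * g j <= g j.
  by rewrite ler_piMl// ler_pdivrMr// mul1r.
have h2' : (\sum_j `|(z - x) ord0 j|) / r * g j <= 2^-1 * g j.
  by rewrite ler_wpM2r// ler_pdivrMr//; lra.
have : diff2 f ((2 * r) *: e_ j) z <= \sum_j diff2 f ((2 * r) *: e_ j) z.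
  rewrite (bigD1 j)//= lerDl; apply: sumr_ge0 => i _; exact: diff2_ge0.
rewrite -/(g j) in h3; lra.
Qed.

End second_difference.

(** Along a line, second differences with step [K e] at points spaced by [e]
    are differences of increments, and their sum telescopes. What is left is
    [K] differences of increments over a step [K e], each at most [D] times
    that step: this is the one-dimensional fact that a bounded monotone
    derivative has bounded variation. *)
Lemma sum_diff2_line (R : realType) (f : R -> R) (lo D a e : R) (K N : nat) :
  0 < e -> (0 < K)%N ->
  (forall x t, 0 <= t -> lo * t <= f (x + t) - f x <= (lo + D) * t) ->
  \sum_(k < N) (f (a + k%:R * e + K%:R * e) + f (a + k%:R * e - K%:R * e)
               - 2 * f (a + k%:R * e)) <= (K%:R * e) ^+ 2 * D / e.
Proof.
move=> e0 K0 Hf; set L := K%:R * e.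
have L0 : 0 < L by rewrite mulr_gt0// ltr0n.
pose g x := f (x + L) - f x.
have -> : \sum_(k < N) (f (a + k%:R * e + L) + f (a + k%:R * e - L)
             - 2 * f (a + k%:R * e)) =
   \sum_(i < K) (g (a - L + i%:R * e + N%:R * e) - g (a - L + i%:R * e)).
  elim: N => [|N IH].
    by rewrite big_ord0 big1// => i _; rewrite mul0r addr0 subrr.
  rewrite big_ord_recr/= IH.
  pose h (i : nat) := g (a - L + i%:R * e + N%:R * e).
  have -> : f (a + N%:R * e + L) + f (a + N%:R * e - L) - 2 * f (a + N%:R * e)
     = h K - h 0%N.
    rewrite /h /g -/L mul0r addr0 subrK.
    have -> : a - L + N%:R * e + L = a + N%:R * e by ring.
    have -> : a - L + N%:R * e = a + N%:R * e - L by ring.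
    ring.
  have -> : h K - h 0%N = \sum_(i < K) (h i.+1 - h i).
    by rewrite -(big_mkord xpredT (fun i => h i.+1 - h i)) telescope_sumr.
  rewrite -big_split/=; apply: eq_bigr => i _.
  rewrite /h -!natr1 !mulrDl !mul1r.
  have -> : a - L + (i%:R * e + e) + N%:R * e = a - L + i%:R * e + (N%:R * e + e).
    by ring.
  ring.
apply: (@le_trans _ _ (\sum_(i < K) (L * D))).
  apply: ler_sum => i _.
  have := Hf (a - L + i%:R * e) L; have := Hf (a - L + i%:R * e + N%:R * e) L.
  rewrite ltW// => /(_ isT)/andP[_ h1] /(_ isT)/andP[h2 _].
  rewrite /g; lra.
rewrite sumr_const card_ord -[leLHS]mulr_natl le_eqVlt; apply/orP; left.
by apply/eqP; rewrite /L; field; rewrite gt_eqF.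
Qed.

(** * Covering by lattice averages *)

Lemma sum_sub1_le (R : realType) (I : finType) (Q : pred I) (F : I -> R) u :
  (forall k, Q k -> k = u) -> 0 <= F u -> \sum_(k | Q k) F k <= F u.
Proof.
move=> Qu Fu; have [k Qk|Q0] := pickP Q; last by rewrite big_pred0.
rewrite (bigD1 k)//= big_pred0 ?addr0 ?(Qu k Qk)// => i.
apply/negbTE; rewrite negb_and negbK -implybE; apply/implyP => /Qu ->.
by rewrite ?(Qu k Qk) eqxx.
Qed.

Lemma ord_mid_subproof h : (h < (2 * h).+1)%N. Proof. by lia. Qed.

Definition ord_mid h := Ordinal (ord_mid_subproof h).

Section lattice.
Context {R : realType} {d : nat}.
Local Notation V := 'rV[R]_d.
Local Notation e_ j := (delta_mx ord0 j : V).
Variables (h : nat) (eps : R).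
Hypothesis eps0 : 0 < eps.
Local Notation I := {ffun 'I_d -> 'I_(2 * h).+1}.

(** A finite box of the lattice of mesh [eps]; the index of a point is
    shifted by [h] so that its coordinates are natural numbers. *)
Definition lattice_pt (k : I) : V := \row_j (eps * ((k j)%:R - h%:R)).

Definition set_coord (k : I) j t : I := [ffun i => if i == j then t else k i].

Lemma lattice_pt_set_coord k j t : lattice_pt (set_coord k j t) =
  lattice_pt (set_coord k j ord0) + (t%:R * eps) *: e_ j.
Proof.
apply/rowP => i; rewrite !mxE !ffunE /=; case: (i == j) => /=; ring.
Qed.

Let mid := ord_mid h.

Lemma enorm_lattice_pt_mid k j : enorm (lattice_pt (set_coord k j mid)) <= enorm (lattice_pt k).
Proof.
apply: enorm_le_coord => i; rewrite !mxE !ffunE; case: (i == j) => //=.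
by rewrite subrr mulr0 normr0.
Qed.

Definition lattice_line j (r : R) : {set I} :=
  [set k : I | (k j == mid) && (enorm (lattice_pt k) < r)].

Definition lattice_ball x (r : R) : {set I} := [set k : I | enorm (lattice_pt k - x) < r].

(** The points of a line segment of length [r] issued from each of the
    points counted on the left are distinct, and by Pythagoras they have
    norm less than [sqrt 2 * r]. *)
Lemma card_line (j : 'I_d) (r : R) (T : nat) : 0 < r -> T%:R * eps <= r ->
  (T <= h)%N -> (#|lattice_line j r| * T.+1 <= #|lattice_ball 0 (3 / 2 * r)|)%N.
Proof.
move=> r0 Tr Th.
pose g (p : I * 'I_T.+1) : I := set_coord p.1 j (inord (h + p.2)).
pose S := finset.setX (lattice_line j r) [set: 'I_T.+1]%SET.
have ginj : {in S &, injective g}.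
  move=> [k t] [k' t']; rewrite !inE /= !andbT => /andP[/eqP kj _] /andP[/eqP kj' _].
  move=> /ffunP E; congr pair.
    apply/ffunP => i; have := E i; rewrite !ffunE.
    by case: eqP => [->|//]; rewrite kj kj'.
  have := E j; rewrite !ffunE eqxx => /(congr1 val) /=.
  rewrite !inordK; [|have := ltn_ord t'; lia|have := ltn_ord t; lia].
  by move/addnI/val_inj.
have -> : (#|lattice_line j r| * T.+1)%N = #|S|.
  by rewrite finset.cardsX cardsT card_ord.
rewrite -(card_in_imset ginj); apply: subset_leq_card; apply/fintype.subsetP => u.
move=> /imsetP[[k t]]; rewrite !inE /= andbT => /andP[/eqP kj kr] ->; rewrite subr0.
have E : lattice_pt (g (k, t)) = lattice_pt k + (t%:R * eps) *: e_ j.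
  apply/rowP => i; rewrite !mxE !ffunE /=; case: (eqVneq i j) => [->|_] /=.
    by rewrite kj inordK /= ?natrD; [ring|have := ltn_ord t; lia].
  by ring.
have lt0 : dotp (e_ j) (lattice_pt k) = 0.
  by rewrite dotp_delta mxE kj subrr mulr0.
have ed : dotp (e_ j) (e_ j) = 1 by rewrite dotp_delta mxE !eqxx.
have r32 : 0 <= 3 / 2 * r by lra.
rewrite E -(@ltr_pXn2r _ 2) ?nnegrE ?enorm_ge0//.
rewrite enorm_sqr dotpDl !dotpDr !dotpZl !dotpZr (dotpC (lattice_pt k)) lt0 ed -enorm_sqr.
have k2 : enorm (lattice_pt k) ^+ 2 < r ^+ 2.
  by rewrite ltr_pXn2r ?nnegrE ?enorm_ge0// ltW.
have t2 : (t%:R * eps) ^+ 2 <= r ^+ 2.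
  have te : 0 <= t%:R * eps by rewrite mulr_ge0// ltW.
  rewrite ler_pXn2r ?nnegrE ?(ltW r0)//.
  apply: le_trans Tr; rewrite ler_pM2r// ler_nat -ltnS; exact: ltn_ord.
rewrite !mulr0 !addr0 add0r mulr1 -expr2; move: k2 t2 (exprn_gt0 2 r0).
have -> : (3 / 2 * r) ^+ 2 = 9 / 4 * r ^+ 2 by field.
lra.
Qed.

(** The scaling and the translation invariance of volume, for numbers of
    lattice points: divide the index of a point of the large ball by [m],
    then translate the quotient to the neighbourhood of [x]. The remainder
    takes [m ^ d] values, and the two roundings cost less than [2 * eps] per
    coordinate. *)
Lemma card_ball (m h' : nat) (x : V) (rho r RX : R) :
  0 < rho -> h = (m * h')%N -> (2 <= m)%N -> RX <= h'%:R * eps ->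
  enorm x <= RX ->
  rho / m%:R + Num.sqrt d%:R * (2 * eps) <= r ->
  (#|lattice_ball 0 rho| <= m ^ d * #|lattice_ball x r|)%N.
Proof.
move=> rho0 hE m2 RXh xRX rhor.
have m0 : (0 < m)%N by exact: leq_trans m2.
pose c j := Num.truncn (x ord0 j / eps + h%:R - h'%:R).
have xb j : `|x ord0 j / eps| <= h'%:R.
  rewrite normrM normfV [`|eps|]gtr0_norm// ler_pdivrMr//.
  exact: le_trans (enorm_coord _ _) (le_trans xRX RXh).
have h2h' : 2 * h'%:R <= h%:R :> R.
  by rewrite hE -natrM ler_nat leq_mul2r m2 orbT.
have ch j : (c j)%:R <= x ord0 j / eps + h%:R - h'%:R < (c j)%:R + 1.
  have := xb j; rewrite ler_norml => /andP[? ?].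
  have := @truncn_itv R (x ord0 j / eps + h%:R - h'%:R).
  by rewrite -natr1; apply; lra.
pose g (k : I) : {ffun 'I_d -> 'I_m} * I :=
  ([ffun j => Ordinal (ltn_pmod (k j) m0)], [ffun j => inord (k j %/ m + c j)]).
have kb (k : I) j : (k j %/ m + c j < (2 * h).+1)%N.
  rewrite ltnS.
  have k1 : (k j %/ m <= 2 * h')%N.
    rewrite -(@mulnK (2 * h') m)// leq_div2r//.
    have := ltn_ord (k j); rewrite ltnS; move: (nat_of_ord (k j)) => kj.
    rewrite hE; lia.
  rewrite -(ler_nat R) natrD natrM.
  have := ch j => /andP[c1 _]; have := xb j; rewrite ler_norml => /andP[_ x1].
  move: k1; rewrite -(ler_nat R) natrM => k1; lra.
have ginj : injective g.
  move=> k k' [/ffunP E1 /ffunP E2]; apply/ffunP => j; apply/val_inj => /=.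
  have := E1 j; rewrite !ffunE => /(congr1 val) /= e1.
  have := E2 j; rewrite !ffunE => /(congr1 val) /=; rewrite !inordK// => /addIn e2.
  by rewrite (divn_eq (k j) m) (divn_eq (k' j) m) e1 e2.
have -> : (m ^ d * #|lattice_ball x r|)%N =
    #|finset.setX [set: {ffun 'I_d -> 'I_m}]%SET (lattice_ball x r)|.
  by rewrite finset.cardsX cardsT card_ffun !card_ord.
rewrite -(card_imset _ ginj); apply: subset_leq_card; apply/fintype.subsetP => u.
move=> /imsetP[k]; rewrite !inE subr0 => kr -> /=.
apply: lt_le_trans rhor.
set z := lattice_pt _.
have mR0 : 0 < m%:R :> R by rewrite ltr0n.
have -> : z - x = m%:R^-1 *: lattice_pt k + (z - x - m%:R^-1 *: lattice_pt k).
  by rewrite [RHS]addrC subrK.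
apply: le_lt_trans (enorm_triangle _ _) _; apply: ltr_leD.
  by rewrite enormZ gtr0_norm ?invr_gt0// mulrC ltr_pM2r// invr_gt0.
apply: enorm_le_sup => [|j]; first by rewrite mulr_ge0// ltW.
rewrite !mxE !ffunE inordK//.
have kE : (k j)%:R = (k j %/ m)%:R * m%:R + (k j %% m)%:R :> R.
  by rewrite {1}(divn_eq (k j) m) natrD natrM.
set q := (k j %/ m)%N in kE *; set b := (k j %% m)%N in kE *.
have b1 : b%:R / m%:R < 1 :> R by rewrite ltr_pdivrMr// mul1r ltr_nat ltn_pmod.
have b0 : 0 <= b%:R / m%:R :> R by rewrite divr_ge0.
have -> : eps * ((q + c j)%N%:R - h%:R) - x ord0 j - m%:R^-1 * (eps * ((k j)%:R - h%:R))
  = - (eps * (b%:R / m%:R + (x ord0 j / eps + h%:R - h'%:R - (c j)%:R))).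
  rewrite kE hE natrD natrM; field; rewrite !gt_eqF//.
have /andP[c1 c2] := ch j.
rewrite normrN normrM gtr0_norm// mulrC ler_pM2r// ger0_norm; lra.
Qed.

(** A discrete Fubini argument: the ball is covered by the lattice lines of
    direction [j] that meet it, and such a line is determined by its point
    in the middle hyperplane, which is again in the ball. *)
Lemma sum_lattice_ball_le (F : V -> R) j (r B : R) : (forall x, 0 <= F x) ->
  (forall a, \sum_(t < (2 * h).+1) F (a + (t%:R * eps) *: e_ j) <= B) ->
  \sum_(k in lattice_ball 0 r) F (lattice_pt k) <= #|lattice_line j r|%:R * B.
Proof.
move=> F0 FB.
rewrite (partition_big (fun k => set_coord k j mid) (mem (lattice_line j r))) /=; last first.
  move=> k; rewrite !inE subr0 => kr; rewrite ffunE eqxx eqxx/=.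
  exact: le_lt_trans (enorm_lattice_pt_mid _ _) kr.
rewrite mulr_natl -sumr_const; apply: ler_sum => k' _.
apply: le_trans (FB (lattice_pt (set_coord k' j ord0))).
rewrite (partition_big (fun k : I => k j) xpredT)//=; apply: ler_sum => t _.
rewrite -lattice_pt_set_coord; apply: (@sum_sub1_le _ _ _ (fun k => F (lattice_pt k))) => //.
move=> k /andP[/andP[_ /eqP <-] /eqP <-]; apply/ffunP => i; rewrite !ffunE.
by case: eqP => [->|].
Qed.

End lattice.

Section covering.
Context {R : realType} {d : nat}.
Local Notation V := 'rV[R]_d.
Local Notation e_ j := (delta_mx ord0 j : V).

(** The map [x |-> sup_v diff2 f v x] is dominated by a combination of
    indicator functions of balls of radius [r] whose total weight is of
    order [RX ^ (d - 1) * D * r ^ (2 - d)]. The weights are averages over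
    lattice points of the coordinate second differences of [f]. Summed along
    a lattice line these are bounded through the oscillation [D] of the
    slope, and the number of lines scales like the volume of a ball of
    dimension [d - 1]. The mesh [eps] is a fixed fraction of [r], and the
    volumes cancel because lattice points are only compared with lattice
    points. *)
Lemma diff2_covering (f : V -> R) (lo : 'I_d -> R) (D RX r : R) :
  (0 < d)%N -> is_cvx f ->
  (forall j x t, 0 <= t ->
     lo j * t <= f (x + t *: e_ j) - f x <= (lo j + D) * t) ->
  0 < r -> 2 * r <= RX ->
  exists (I : finType) (z : I -> V) (w : I -> R),
    [/\ forall i, 0 <= w i,
        forall x v, enorm x <= RX -> enorm v <= 2 * r ->
          diff2 f v x <= \sum_i w i * (enorm (z i - x) < r)%R%:R &
        \sum_i w i <=
          16 * d%:R ^+ 2 * D * (7 / 2) ^+ d * RX ^+ d.-1 * r ^+ 2 / r ^+ d].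
Proof.
move=> d0 cf Hf r0 rRX.
have RX0 : 0 < RX by lra.
set sd : R := Num.sqrt d%:R.
have sd0 : 0 < sd by rewrite sqrtr_gt0 ltr0n.
have sd2 : sd ^+ 2 = d%:R by rewrite sqr_sqrtr.
(* The rounding error [2 * eps] per coordinate is then [r / 4] in norm, and
   the step [L] below is an integral multiple of [eps]. *)
pose eps := r / (8 * sd).
have eps0 : 0 < eps by rewrite divr_gt0// mulr_gt0.
pose R' := RX + r.
have R'0 : 0 < R' by rewrite /R'; lra.
(* The ratio, rounded up, of the radius [3 / 2 * R'] of the large ball to
   the radius [3 / 4 * r] that is left once the rounding errors are
   subtracted from [r]. *)
pose m := (Num.truncn (2 * R' / r)).+1.
have xm : 0 <= 2 * R' / r by rewrite divr_ge0 ?mulr_ge0 ?ltW.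
have [m1 m2] : 2 * R' / r <= m%:R /\ m%:R <= 2 * R' / r + 1.
  have /andP[h1 h2] := truncn_itv xm; split; first exact: ltW.
  by rewrite /m -natr1 lerD2r.
have m3 : m%:R <= 7 / 2 * (RX / r).
  apply: le_trans m2 _.
  have -> : 2 * R' / r + 1 = 2 * (RX / r) + 3 by rewrite /R'; field; rewrite gt_eqF.
  have : 2 <= RX / r by rewrite ler_pdivlMr.
  lra.
have m4 : (2 <= m)%N.
  rewrite -(ler_nat R); apply: le_trans m1; rewrite ler_pdivlMr//.
  by rewrite ler_pM2l//; rewrite /R'; lra.
(* The box is large enough for the lattice lines and for the translations. *)
pose h' := (Num.truncn (RX / eps)).+1.
have RXh : RX <= h'%:R * eps.
  have := @truncn_itv R (RX / eps).
  rewrite divr_ge0 ?(ltW RX0) ?(ltW eps0)// => /(_ isT)/andP[_]; rewrite -/h'.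
  by rewrite ltr_pdivrMr// => /ltW.
pose h := (m * h')%N.
pose T := Num.truncn (R' / eps).
have /andP[T1 T2] : T%:R <= R' / eps < T.+1%:R.
  by apply: truncn_itv; rewrite divr_ge0 ?ltW.
rewrite ler_pdivlMr// in T1; rewrite ltr_pdivrMr// in T2.
have h2h' : 2 * h'%:R <= h%:R :> R.
  by rewrite /h -natrM ler_nat leq_mul2r m4 orbT.
have Th : (T <= h)%N.
  rewrite -(ler_nat R) -(ler_pM2r eps0); apply: le_trans T1 _.
  have : 2 * h'%:R * eps <= h%:R * eps by rewrite ler_pM2r.
  by rewrite /R'; lra.
pose z := @lattice_pt R d h eps.
pose L := 4 * r * sd.
have LE : L = (32 * d)%N%:R * eps.
  rewrite /L /eps natrM -sd2; field; rewrite gt_eqF//.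
pose G x := \sum_j diff2 f (L *: e_ j) x.
have G0 x : 0 <= G x by apply: sumr_ge0 => j _; exact: diff2_ge0.
pose Big := lattice_ball h eps (0 : V) (3 / 2 * R').
pose A := lattice_ball h eps (0 : V) R'.
have Big0 : (0 < #|Big|)%N.
  apply/card_gt0P; exists [ffun=> ord_mid h]; rewrite inE subr0.
  have -> : lattice_pt eps [ffun=> ord_mid h] = 0 :> V.
    by apply/rowP => i; rewrite !mxE ffunE /= subrr mulr0.
  by rewrite enorm0; lra.
have BigR : 0 < #|Big|%:R :> R by rewrite ltr0n.
pose C : R := (m ^ d)%N%:R / #|Big|%:R.
have C0 : 0 <= C by rewrite divr_ge0.
exists {ffun 'I_d -> 'I_(2 * h).+1}, z, (fun k => if k \in A then C * G (z k) else 0).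
split.
- by move=> k; case: ifP => // _; rewrite mulr_ge0.
- move=> x v xRX vr; set q := diff2 f v x.
  have q0 : 0 <= q by exact: diff2_ge0.
  pose S := lattice_ball h eps x r.
  have cS : (#|Big| <= m ^ d * #|S|)%N.
    apply: (@card_ball _ _ _ _ eps0 m h' x _ _ RX) => //; first by lra.
    have -> : Num.sqrt d%:R * (2 * eps) = r / 4.
      by rewrite -/sd /eps; field; rewrite gt_eqF.
    suff : 3 / 2 * R' / m%:R <= 3 / 4 * r by lra.
    have mR0 : 0 < m%:R :> R by rewrite ltr0n.
    rewrite ler_pdivrMr//; move: m1; rewrite ler_pdivrMr//; lra.
  have SA k : k \in S -> k \in A.
    rewrite !inE subr0 => kr.
    have := enorm_triangle (lattice_pt eps k - x) x; rewrite subrK => h1.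
    by rewrite (le_lt_trans h1)// /R'; lra.
  have qG k : k \in S -> q <= G (z k).
    rewrite inE => kr; rewrite /q /G.
    have -> : L = 2 * (2 * r * sd) by rewrite /L; ring.
    apply: diff2_le_sum => //; first by rewrite !mulr_gt0.
      apply: le_trans (norm1_le_enorm _) _.
      by rewrite [leRHS]mulrC ler_pM2l.
    apply: le_trans (norm1_le_enorm _) _.
    have -> : 2 * r * sd / 2 = sd * r by field.
    by rewrite ler_pM2l// ltW.
  apply: (@le_trans _ _ (C * \sum_(k in S) G (z k))); last first.
    rewrite mulr_sumr big_mkcond /=; apply: ler_sum => k _.
    have := SA k; rewrite [k \in S]inE /z; case: ifP => kr.
      by move=> ->//; rewrite mulr1.
    by rewrite mulr0.
  have sS : #|S|%:R * q <= \sum_(k in S) G (z k).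
    rewrite mulr_natl -sumr_const; exact: ler_sum.
  rewrite /C mulrAC ler_pdivlMr//.
  apply: le_trans (ler_wpM2l _ sS) => //; rewrite mulrA -natrM.
  by rewrite mulrC ler_wpM2r// ler_nat.
- rewrite -big_mkcond /= -mulr_sumr.
  pose bnd := #|Big|%:R / R' * (L ^+ 2 * D).
  have D0 : 0 <= D.
    have j0 : 'I_d by exact: (Ordinal d0).
    have := Hf j0 0 1 ler01; rewrite !mulr1 => /andP[/le_trans h1 /h1]; lra.
  have line j : \sum_(k in A) diff2 f (L *: e_ j) (z k) <= bnd.
    apply: le_trans (@sum_lattice_ball_le _ _ h eps (fun x => diff2 f (L *: e_ j) x) j R'
      (L ^+ 2 * D / eps) _ _) _.
    + by move=> x; exact: diff2_ge0.
    + move=> a.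
      have Hl s t : 0 <= t ->
          lo j * t <= f (a + (s + t) *: e_ j) - f (a + s *: e_ j)
                   <= (lo j + D) * t.
        by move=> t0; have := Hf j (a + s *: e_ j) t t0; rewrite -addrA -scalerDl.
      have := @sum_diff2_line R (fun s => f (a + s *: e_ j)) (lo j) D 0 eps
         (32 * d) (2 * h).+1 eps0.
      rewrite muln_gt0 d0 -LE => /(_ isT Hl); apply: le_trans.
      rewrite le_eqVlt; apply/orP; left; apply/eqP; apply: eq_bigr => t _.
      by rewrite /diff2 add0r !scalerDl scaleNr !addrA.
    + have := card_line eps0 j R'0 T1 Th; rewrite -(ler_nat R) natrM => cl.
      have : #|lattice_line h eps j R'|%:R * R' <= #|Big|%:R * eps.
        apply: le_trans (_ : #|lattice_line h eps j R'|%:R * (T.+1%:R * eps) <= _).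
          by rewrite ler_wpM2l// ltW.
        by rewrite mulrA ler_pM2r.
      rewrite -ler_pdivlMr// => cl2.
      have -> : bnd = (#|Big|%:R * eps / R') * (L ^+ 2 * D / eps).
        by rewrite /bnd; field; rewrite !gt_eqF.
      by rewrite ler_wpM2r// divr_ge0 ?(ltW eps0)// mulr_ge0// sqr_ge0.
  have sumA : \sum_(k in A) G (z k) <= d%:R * bnd.
    rewrite /G exchange_big /= -[d in leRHS]card_ord mulr_natl -sumr_const.
    by apply: ler_sum => j _; exact: line.
  apply: le_trans (ler_wpM2l C0 sumA) _.
  have -> : C * (d%:R * bnd) = m%:R ^+ d * (d%:R * (L ^+ 2 * D) / R').
    by rewrite /C /bnd natrX; field; rewrite !gt_eqF.
  have mr : m%:R ^+ d <= (7 / 2 * (RX / r)) ^+ d by rewrite lerXn2r ?nnegrE//; lra.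
  have W0 : 0 <= d%:R * (L ^+ 2 * D) by rewrite mulr_ge0// mulr_ge0// sqr_ge0.
  apply: (@le_trans _ _ ((7 / 2 * (RX / r)) ^+ d * (d%:R * (L ^+ 2 * D) / RX))).
    apply: ler_pM => //; first by rewrite divr_ge0// ltW.
    rewrite ler_wpM2l// lef_pV2 ?posrE// /R'; lra.
  have L2 : L ^+ 2 = 16 * d%:R * r ^+ 2 by rewrite /L -sd2; ring.
  have RXd : RX ^+ d = RX * RX ^+ d.-1 by rewrite -exprS prednK.
  rewrite L2 exprMn [(RX / r) ^+ d]expr_div_n RXd.
  move: (exprn_gt0 d r0) ((7 / 2) ^+ d) => rd0 c.
  rewrite le_eqVlt; apply/orP; left; apply/eqP; field.
  by rewrite !gt_eqF.
Qed.

End covering.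

(** * Volumes of balls *)

Section volume.
Context {R : realType}.
Local Notation mu := (@lebesgue_measure R).

Lemma lebesgue_measure_scale (r : R) (A : set R) : 0 < r -> measurable A ->
  pushforward mu (fun t : measurableTypeR R => t / r : measurableTypeR R) A
  = (r%:E * mu A)%E.
Proof.
move=> r0 mA.
have r0' : 0 <= r^-1 by rewrite invr_ge0 ltW.
have mf : measurable_fun setT
    (fun t : measurableTypeR R => t / r : measurableTypeR R).
  exact: measurable_funM.
pose f (t : measurableTypeR R) := t / r : measurableTypeR R.
pose nu := mscale (NngNum r0') (pushforward mu f).
have -> : mu A = nu mf A.
  apply: lebesgue_measure_unique mA => _ [[a b]] _ <-.
  change (mu `]a, b]%classic = (r^-1)%:E * mu (f @^-1` `]a, b]%classic))%E.
  have -> : f @^-1` `]a, b] = `](a * r), (b * r)]%classic :> set R.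
    by apply/seteqP; split => t /=; rewrite !in_itv /= ltr_pdivlMr// ler_pdivrMr.
  rewrite !lebesgue_measure_itv/= !lte_fin ltr_pM2r//.
  case: ifP => _; last by rewrite mule0.
  rewrite -!EFinB -EFinM; congr EFin; field; exact: lt0r_neq0.
rewrite /nu /mscale /= muleA -EFinM divff ?mul1e//; exact: lt0r_neq0.
Qed.

Lemma integral_scale (r : R) (f : R -> \bar R) : 0 < r ->
  measurable_fun setT f -> (forall x, 0 <= f x)%E ->
  (\int[mu]_t f (t / r)%R = r%:E * \int[mu]_t f t)%E.
Proof.
move=> r0 mf f0.
have mg : measurable_fun setT
    (fun t : measurableTypeR R => t / r : measurableTypeR R).
  exact: measurable_funM.
have r0' : 0 <= r by exact: ltW.
have := @ge0_integral_pushforward _ _ _ _ _ _ mg mu setT f measurableT mf.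
rewrite preimage_setT => <-; last by move=> y _.
rewrite -(@ge0_integral_mscale _ _ _ mu _ measurableT (NngNum r0') f)//.
apply: eq_measure_integral => A mA _.
exact: etrans (lebesgue_measure_scale r0 mA) _.
Qed.

Lemma enorm_row_mx k (t : R) (v : 'rV[R]_k) :
  enorm (row_mx (t%:M : 'rV_1) v) = Num.sqrt (t ^+ 2 + enorm v ^+ 2).
Proof.
rewrite /enorm sqr_sqrtr ?dotp_ge0// /dotp big_split_ord /= big_ord1.
rewrite row_mxEl mxE eqxx mulr1n -expr2; congr (Num.sqrt (_ + _)).
by apply: eq_bigr => i _; rewrite row_mxEr.
Qed.

(** The case [|t| >= r] is kept apart because the volume formula below is
    for balls of positive radius. *)
Lemma section_eball k (r t : R) : 0 < r ->
  [set v : 'rV[R]_k | eball (0 : 'rV_k.+1) r (row_mx (t%:M : 'rV_1) v)]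
  = if `|t| < r then eball 0 (Num.sqrt (r ^+ 2 - t ^+ 2)) else set0.
Proof.
move=> r0.
have E (v : 'rV[R]_k) : eball (0 : 'rV_k.+1) r (row_mx (t%:M : 'rV_1) v) <->
    enorm v ^+ 2 < r ^+ 2 - t ^+ 2.
  rewrite /eball /= subr0 (@enorm_row_mx k) ltrBrDl.
  rewrite -{1}[r]gtr0_norm// -sqrtr_sqr ltr_sqrt// exprn_gt0//.
case: ifPn => tr; apply/seteqP; split => v /=.
- move/E; rewrite /eball /= subr0 => h.
  rewrite -[enorm v]ger0_norm ?enorm_ge0// -sqrtr_sqr ltr_sqrt//.
  exact: le_lt_trans (sqr_ge0 _) h.
- move=> h; apply/E; move: h; rewrite /eball /= subr0 => h.
  rewrite -[ltRHS]sqr_sqrtr; first by rewrite ltr_pXn2r// nnegrE ?enorm_ge0 ?sqrtr_ge0.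
  rewrite subr_ge0 -[t ^+ 2]real_normK ?num_real//.
  by rewrite ler_pXn2r ?nnegrE ?(ltW r0)// ltW.
- move/E => h; rewrite -leNgt in tr; move: h; apply/negP; rewrite -leNgt.
  rewrite (@le_trans _ _ 0) ?sqr_ge0// subr_le0 -[t ^+ 2]real_normK ?num_real//.
  by rewrite ler_pXn2r ?nnegrE ?(ltW r0).
- by [].
Qed.

(** The volume of the section of the unit ball of dimension [k + 1] at
    height [t], when [b] is the volume of the unit ball of dimension [k]. *)
Definition ball_profile k (b t : R) : R :=
  b * Num.sqrt (1 - t ^+ 2) ^+ k * \1_(`]-1, 1[%classic : set R) t.

Lemma ball_profile_ge0 k b t : 0 <= b -> 0 <= ball_profile k b t.
Proof. by move=> b0; rewrite !mulr_ge0// exprn_ge0// sqrtr_ge0. Qed.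

Lemma measurable_ball_profile k b : measurable_fun setT (ball_profile k b).
Proof.
apply: measurable_funM; last by apply: measurable_indic.
apply: measurable_funM => //; apply: measurable_funX.
apply: measurableT_comp => //; first exact: continuous_measurable_fun (@sqrt_continuous R).
by apply: measurable_funB => //; exact: measurable_funX.
Qed.

Lemma ball_profile_scale k b r t : 0 < r ->
  (if `|t| < r then b * Num.sqrt (r ^+ 2 - t ^+ 2) ^+ k else 0)
  = r ^+ k * ball_profile k b (t / r).
Proof.
move=> r0; rewrite /ball_profile indicE.
have -> : (t / r \in (`]-1, 1[%classic : set R)) = (`|t| < r).
  rewrite mem_setE /= in_itv/= -ltr_norml normrM normfV (gtr0_norm r0).
  by rewrite ltr_pdivrMr// mul1r.
case: ifP => _; rewrite ?mulr0// mulr1.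
have -> : r ^+ 2 - t ^+ 2 = r ^+ 2 * (1 - (t / r) ^+ 2).
  by field; exact: lt0r_neq0.
rewrite sqrtrM ?sqr_ge0// sqrtr_sqr gtr0_norm// exprMn; ring.
Qed.

(** The volume of a ball is computed by slicing. The lower bound for [b']
    keeps only the heights between -3/5 and 3/5, where the section contains
    the ball of radius 4/5. *)
Lemma ball_volume_step k (b : R) : 0 < b ->
  (forall r : R, 0 < r -> lebesgue_rV (eball (0 : 'rV[R]_k) r) = (b * r ^+ k)%:E) ->
  exists b' : R, [/\ 6 / 5 * (4 / 5) ^+ k * b <= b' &
    forall r : R, 0 < r ->
      lebesgue_rV (eball (0 : 'rV[R]_k.+1) r) = (b' * r ^+ k.+1)%:E].
Proof.
move=> b0 Hb.
have F0 : lebesgue_rV (set0 : set 'rV[R]_k) = 0%E.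
  case: k Hb => [|k] Hb /=; first by rewrite dirac0.
  elim: k {Hb} => [|k IH] /=.
    by apply: integral0_eq => t _; rewrite (_ : [set v | _] = set0) ?dirac0.
  by apply: integral0_eq => t _; rewrite (_ : [set v | _] = set0).
pose g t := (ball_profile k b t)%:E.
have mg : measurable_fun setT g by apply/measurable_EFinP; exact: measurable_ball_profile.
have g0 t : (0 <= g t)%E by rewrite lee_fin ball_profile_ge0// ltW.
have glo : ((6 / 5 * (4 / 5) ^+ k * b)%:E <= \int[mu]_t g t)%E.
  have -> : (6 / 5 * (4 / 5) ^+ k * b)%:E =
      (\int[mu]_(t in `[(- (3 / 5))%R, (3 / 5)%R]) (((4 / 5) ^+ k * b)%:E))%E.
    rewrite integral_cst//= lebesgue_measure_itv/= lte_fin.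
    rewrite ifT; last lra.
    by rewrite -EFinB -EFinM; congr EFin; field.
  apply: (@le_trans _ _ (\int[mu]_(t in `[(- (3 / 5))%R, (3 / 5)%R]) g t)%E).
    apply: ge0_le_integral => //.
    - by move=> t _; rewrite lee_fin mulr_ge0// ?exprn_ge0// ltW.
    - exact: measurable_funS mg.
    - move=> t /=; rewrite in_itv/= => /andP[t1 t2].
      rewrite lee_fin /ball_profile indicE mem_setE /= in_itv/=.
      have -> : (-1 < t < 1) by lra.
      rewrite mulr1 mulrC ler_pM2l//.
      have -> : 4 / 5 = Num.sqrt ((4 / 5) ^+ 2) :> R by rewrite sqrtr_sqr ger0_norm; lra.
      rewrite lerXn2r ?nnegrE ?sqrtr_ge0// ler_wsqrtr//.
      have : t ^+ 2 <= (3 / 5) ^+ 2.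
        by rewrite -[leLHS]real_normK ?num_real// ler_pXn2r ?nnegrE// ?ler_norml; lra.
      lra.
  by apply: ge0_subset_integral.
have ghi : (\int[mu]_t g t < +oo)%E.
  apply: (@le_lt_trans _ _ (\int[mu]_t (b * \1_(`]-1, 1[%classic : set R) t)%:E)%E).
    apply: ge0_le_integral => //.
    - by apply/measurable_EFinP; apply: measurable_funM => //; exact: measurable_indic.
    move=> t _; rewrite lee_fin ler_wpM2r// ger_pMr// exprn_ile1 ?sqrtr_ge0//.
    by rewrite -[leRHS]sqrtr1 ler_wsqrtr// gerBl sqr_ge0.
  under eq_integral do rewrite EFinM.
  rewrite ge0_integralZl//; [|exact/measurable_EFinP/measurable_indic|by rewrite lee_fin ltW].
  rewrite integral_indic// setIT/= lebesgue_measure_itv/= lte_fin ifT; last lra.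
  by rewrite -EFinB -EFinM ltry.
have gfin : (\int[mu]_t g t)%E \is a fin_num.
  by rewrite ge0_fin_numE// integral_ge0.
exists (fine (\int[mu]_t g t)); split; first by rewrite -lee_fin fineK.
move=> r r0 /=.
transitivity (\int[mu]_t ((r ^+ k)%:E * g (t / r)%R))%E.
  apply: eq_integral => t _; rewrite section_eball//.
  rewrite /g -EFinM -ball_profile_scale//; case: ifP => // tr.
  rewrite Hb// sqrtr_gt0 subr_gt0 -[ltLHS]real_normK ?num_real//.
  by rewrite ltr_pXn2r ?nnegrE// ltW.
rewrite ge0_integralZl//.
- by rewrite integral_scale// EFinM fineK// muleA -EFinM -exprSr muleC.
- by apply: measurableT_comp => //; exact: measurable_funM.
- by rewrite lee_fin exprn_ge0// ltW.
Qed.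

Lemma lebesgue_eball k : 0 < unit_ball_volume R k /\ forall r : R, 0 < r ->
  lebesgue_rV (eball (0 : 'rV[R]_k) r) = (unit_ball_volume R k * r ^+ k)%:E.
Proof.
suff [b [b0 Hb]] : exists b : R, 0 < b /\ forall r : R, 0 < r ->
    lebesgue_rV (eball (0 : 'rV[R]_k) r) = (b * r ^+ k)%:E.
  have -> : unit_ball_volume R k = b.
    by rewrite /unit_ball_volume Hb// expr1n mulr1.
  by [].
elim: k => [|k [b [b0 Hb]]].
  exists 1; split => // r r0 /=; rewrite mul1r diracE mem_set//=.
  by rewrite /eball /= subrr enorm0.
have [b' [bb' Hb']] := ball_volume_step b0 Hb.
exists b'; split => //; apply: lt_le_trans bb'.
by rewrite !mulr_gt0// exprn_gt0//; lra.
Qed.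

Lemma unit_ball_volume_ratio k :
  6 / 5 * (4 / 5) ^+ k <= unit_ball_volume R k.+1 / unit_ball_volume R k.
Proof.
have [b0 Hb] := lebesgue_eball k.
have [b' [bb' Hb']] := ball_volume_step b0 Hb.
rewrite ler_pdivlMr//; apply: le_trans bb' _.
by rewrite {1}/unit_ball_volume Hb'// expr1n mulr1.
Qed.

End volume.

(** * Kantorovich duality for finite plans *)

Lemma continuous_sumr (R : realType) (T : topologicalType) (I : Type) (r : seq I)
    (F : I -> T -> R) :
  (forall i, continuous (F i)) -> continuous (fun x => \sum_(i <- r) F i x).
Proof.
move=> cF; elim: r => [|i r IH].
  by under eq_fun do rewrite big_nil; exact: cst_continuous.
under eq_fun do rewrite big_cons.
by move=> x; apply: cvgD; [exact: cF|exact: IH].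
Qed.

Section finite_transport.
Context {R : realType} {I J : finType}.
Implicit Types (K s : I -> J -> R).

Definition fplan (r : I -> R) (c : J -> R) : set (I -> J -> R) :=
  [set K | [/\ forall i j, 0 <= K i j, forall i, \sum_j K i j = r i &
     forall j, \sum_i K i j = c j]].

Definition fgain s K := \sum_i \sum_j K i j * s i j.

(** The plans with given marginals form a compact set of matrices. *)
Lemma fplan_max s r c K0 : fplan r c K0 ->
  exists2 K, fplan r c K & forall K', fplan r c K' -> fgain s K' <= fgain s K.
Proof.
move=> K0P.
pose N := #|{: I * J}|.
pose toK (v : 'rV[R]_N) i j : R := v ord0 (enum_rank (i, j)).
pose ofK K : 'rV[R]_N := \row_k K (enum_val k).1 (enum_val k).2.
have ofKK K i j : toK (ofK K) i j = K i j by rewrite /toK mxE enum_rankK.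
have ctoK i j : continuous (fun v : 'rV[R]_N => toK v i j).
  exact: coord_continuous.
pose A := [set v : 'rV[R]_N | fplan r c (toK v)].
have cA : compact A.
  apply: (@subclosed_compact _ A
     [set v : 'rV[R]_N | forall k, `[0, \sum_i r i]%classic (v ord0 k)]).
  - have -> : A = (\bigcap_(p : I * J) [set v | 0 <= toK v p.1 p.2]) `&`
       ((\bigcap_(i : I) [set v | \sum_j toK v i j = r i]) `&`
        (\bigcap_(j : J) [set v | \sum_i toK v i j = c j])).
      apply/seteqP; split => [v [v0 vr vc]|v [v0 [vr vc]]].
        by split => [p _|]; [exact: v0|split => [i _|j _]; [exact: vr|exact: vc]].
      split => [i j|i|j]; [exact: (v0 (i, j))|exact: vr|exact: vc].
    apply: closedI; [|apply: closedI]; apply: closed_bigI => p _.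
    + by apply: (@closed_comp _ _ (fun v => toK v p.1 p.2) [set x | 0 <= x]) => [v _|];
        [exact: ctoK|exact: closed_ge].
    + apply: (@closed_comp _ _ (fun v => \sum_j toK v p j) [set x | x = r p]) => [v _|];
        [|exact: closed_eq].
      by apply: continuous_sumr => j; exact: ctoK.
    + apply: (@closed_comp _ _ (fun v => \sum_i toK v i p) [set x | x = c p]) => [v _|];
        [|exact: closed_eq].
      by apply: continuous_sumr => j; exact: ctoK.
  - by apply: (@rV_compact _ _ (fun=> `[0, \sum_i r i]%classic)) => _; exact: segment_compact.
  - move=> v [v0 vr vc] k /=; rewrite in_itv/=.
    have [i [j <-]] : exists i j, enum_rank (i, j) = k.
      by exists (enum_val k).1, (enum_val k).2; rewrite -surjective_pairing enum_valK.
    rewrite -/(toK v i j) v0/= (bigD1 i)//= -(vr i) (bigD1 j)//= -addrA lerDl addr_ge0//.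
      by apply: sumr_ge0 => *; exact: v0.
    by apply: sumr_ge0 => i' _; rewrite -(vr i'); apply: sumr_ge0 => *; exact: v0.
have A0 : A !=set0.
  exists (ofK K0); case: K0P => h1 h2 h3; split => [i j|i|j]; first by rewrite ofKK.
    by rewrite -(h2 i); apply: eq_bigr => j _; rewrite ofKK.
  by rewrite -(h3 j); apply: eq_bigr => i _; rewrite ofKK.
have [|v vA Hv] := @compact_EVT_max _ R (fun v => fgain s (toK v)) A A0 cA.
  apply: continuous_subspaceT => v.
  apply: continuous_sumr => i; apply: continuous_sumr => j {}v.
  have := @cvgM _ _ _ _ (fun v => toK v i j) (fun=> s i j) (toK v i j) (s i j) (ctoK i j v) (cvg_cst _).
  by move=> H; apply: H; exact: nbhs_filter.
exists (toK v); first by rewrite inE in vA.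
move=> K [h1 h2 h3].
have -> : fgain s K = fgain s (toK (ofK K)).
  by apply: eq_bigr => i _; apply: eq_bigr => j _; rewrite ofKK.
apply: Hv; rewrite inE; split => [i j|i|j]; first by rewrite ofKK.
  by rewrite -(h2 i); apply: eq_bigr => j _; rewrite ofKK.
by rewrite -(h3 j); apply: eq_bigr => i _; rewrite ofKK.
Qed.

(** A chain [e_n; ...; e_1] of pairs of indices ending at [i] moves a unit
    of mass from the pair [e_k] to the pair with the same column and the row
    of [e_(k+1)], the last row being [i]. The chain is closed when [i] is
    the row of [e_1], which is [chain_start]. *)
Fixpoint chain_gain s (l : seq (I * J)) i : R :=
  if l is e :: l' then s i e.2 - s e.1 e.2 + chain_gain s l' e.1 else 0.

Fixpoint chain_start (l : seq (I * J)) i : I :=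
  if l is e :: l' then chain_start l' e.1 else i.

Fixpoint chain_move (l : seq (I * J)) i : I -> J -> R :=
  if l is e :: l' then fun a b => ((a == i) && (b == e.2))%:R -
     ((a == e.1) && (b == e.2))%:R + chain_move l' e.1 a b
  else fun _ _ => 0.

Lemma sum_pair_delta s i j :
  \sum_a \sum_b ((a == i) && (b == j))%:R * s a b = s i j.
Proof.
rewrite (bigD1 i)//= (bigD1 j)//= !eqxx mul1r big1 ?addr0 => [|b /negbTE ->].
  rewrite big1 ?addr0// => a /negbTE ->.
  by rewrite big1// => b _; rewrite mul0r.
by rewrite mul0r.
Qed.

Lemma chain_move_gain s l i : fgain s (chain_move l i) = chain_gain s l i.
Proof.
elim: l i => [|e l IH] i /=.
  by apply: big1 => a _; apply: big1 => b _; rewrite mul0r.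
rewrite -IH -(sum_pair_delta s i e.2) -(sum_pair_delta s e.1 e.2) /fgain.
rewrite -sumrB -big_split; apply: eq_bigr => a _ /=.
rewrite -sumrB -big_split; apply: eq_bigr => b _ /=.
by rewrite mulrDl mulrBl.
Qed.

Lemma sum_delta (T : finType) (x : T) (P : bool) :
  \sum_y (P && (y == x))%:R = P%:R :> R.
Proof.
rewrite (bigD1 x)//= eqxx andbT big1 ?addr0// => y /negbTE ->.
by rewrite andbF.
Qed.

Lemma chain_move_row l i a : \sum_b chain_move l i a b =
  (a == i)%:R - (a == chain_start l i)%:R.
Proof.
elim: l i => [|e l IH] i /=; first by rewrite big1// subrr.
by rewrite big_split /= sumrB !sum_delta IH; ring.
Qed.

Lemma chain_move_col l i b : \sum_a chain_move l i a b = 0.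
Proof.
elim: l i => [|e l IH] i /=; first by rewrite big1.
rewrite big_split /= sumrB IH addr0.
under eq_bigr do rewrite andbC.
by rewrite sum_delta; under eq_bigr do rewrite andbC; rewrite sum_delta subrr.
Qed.

Lemma chain_move_ge (Q : I * J -> Prop) l i a b :
  (forall e, e \in l -> Q e) ->
  chain_move l i a b < 0 -> Q (a, b).
Proof.
elim: l i => [|e l IH] i lQ /=; first by rewrite ltxx.
have [l0 _|l0] := ltP (chain_move l e.1 a b) 0.
  by apply: IH l0 => e' le; apply: lQ; rewrite inE le orbT.
have [ea|_] := boolP ((a == e.1) && (b == e.2)).
  by move: ea => /andP[/eqP -> /eqP ->] _; rewrite -surjective_pairing; apply: lQ; rewrite inE eqxx.
by rewrite subr0 ltNge addr_ge0.
Qed.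

Lemma chain_move_lb l i a b : - (size l)%:R <= chain_move l i a b.
Proof.
elim: l i => [|e l IH] i /=; first by rewrite oppr0.
have := IH e.1; rewrite -natr1.
by case: (_ && _); case: (_ && _) => /=; lra.
Qed.

(** Rerouting a small amount of mass along a closed chain keeps the
    marginals, so a maximal plan cannot gain by it. This is the cyclical
    monotonicity of its support. *)
Lemma closed_chain_gain s r c K : fplan r c K ->
  (forall K', fplan r c K' -> fgain s K' <= fgain s K) ->
  forall l i, (forall e, e \in l -> 0 < K e.1 e.2) -> chain_start l i = i ->
  chain_gain s l i <= 0.
Proof.
move=> [K0 Kr Kc] Kmax l i lK li.
(* The inverse of [S] is a positive lower bound for the positive entries of
   [K]. *)
pose S : R := 1 + \sum_(p : I * J) (K p.1 p.2)^-1.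
have SV p : (K p.1 p.2)^-1 <= S.
  rewrite /S (bigD1 p)//= addrCA lerDl addr_ge0// sumr_ge0// => q _.
  by rewrite invr_ge0.
have S0 : 0 < S.
  by rewrite ltr_wpDr// sumr_ge0// => p _; rewrite invr_ge0.
pose k := S^-1 / (size l).+1%:R.
have k0 : 0 < k by rewrite divr_gt0 ?invr_gt0.
pose K' a b := K a b + k * chain_move l i a b.
have K'P : fplan r c K'.
  split => [a b|a|b].
  - rewrite /K'; have [m0|m0] := leP 0 (chain_move l i a b).
      by rewrite addr_ge0// mulr_ge0// ltW.
    have Kab : 0 < K a b by exact: (@chain_move_ge (fun e => 0 < K e.1 e.2) l i a b lK m0).
    have h1 : S^-1 <= K a b.
      by rewrite -[leRHS]invrK lef_pV2 ?posrE ?invr_gt0//; exact: (SV (a, b)).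
    have h2 := chain_move_lb l i a b.
    suff : - S^-1 <= k * chain_move l i a b by lra.
    apply: (@le_trans _ _ (k * - (size l)%:R)); last by rewrite ler_pM2l.
    rewrite mulrN lerN2 /k -mulrA ger_pMr ?invr_gt0// mulrC ler_pdivrMr// mul1r.
    by rewrite ler_nat.
  - by rewrite big_split /= Kr -mulr_sumr chain_move_row li subrr mulr0 addr0.
  - by rewrite big_split /= Kc -mulr_sumr chain_move_col mulr0 addr0.
have := Kmax _ K'P.
have -> : fgain s K' = fgain s K + k * chain_gain s l i.
  rewrite -chain_move_gain /fgain mulr_sumr -big_split; apply: eq_bigr => a _.
  by rewrite mulr_sumr -big_split; apply: eq_bigr => b _; rewrite mulrDl mulrA.
by rewrite gerDl pmulr_rle0.
Qed.

(** The potentials are Rockafellar's: [f i] is the supremum of the gains of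
    the chains of support pairs of a maximal plan that end at [i]. It is
    finite because a closed chain gains nothing. The pair [f], [g] is tight
    on that support, so its total is the maximal gain, which [K0] misses by
    at most [tau]. *)
Lemma finite_duality s r c K0 (tau : R) : fplan r c K0 ->
  (forall K, fplan r c K -> fgain s K <= fgain s K0 + tau) ->
  exists (f : I -> R) (g : J -> R), (forall i j, s i j <= f i + g j) /\
    \sum_i f i * r i + \sum_j g j * c j <= fgain s K0 + tau.
Proof.
move=> K0P K0max.
have [K KP Kmax] := fplan_max s K0P.
have cyc := closed_chain_gain KP Kmax.
pose adm (l : seq (I * J)) := forall e, e \in l -> 0 < K e.1 e.2.
pose G i := [set chain_gain s l i | l in [set l | adm l]].
pose B : R := \sum_i \sum_j `|s i j|.
have B0 : 0 <= B by apply: sumr_ge0 => i _; exact: sumr_ge0.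
have Bs i j : `|s i j| <= B.
  rewrite /B (bigD1 i)//= (bigD1 j)//= -addrA lerDl addr_ge0 ?sumr_ge0//.
  by move=> ? _; exact: sumr_ge0.
have Gub i : ubound (G i) (B + B).
  move=> _ [l lK <-]; case: l lK => [|e l] lK /=; first by rewrite addr_ge0.
  have := cyc (e :: l) (chain_start (e :: l) i) lK erefl => /=.
  set i0 := chain_start _ _.
  have := Bs i e.2; have := Bs i0 e.2; rewrite !ler_norml; lra.
have G0 i : G i !=set0 by exists 0; exists [::].
have Gsup i : has_sup (G i) by split => //; exists (B + B); exact: Gub.
pose f i := sup (G i).
have fK i0 j i : 0 < K i0 j -> s i j - s i0 j + f i0 <= f i.
  move=> Kij.
  rewrite -lerBrDl; apply: ge_sup => // _ [l lK <-].
  rewrite lerBrDl; apply: ub_le_sup; first by exists (B + B); exact: Gub.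
  exists ((i0, j) :: l) => // e; rewrite inE => /predU1P[->//|]; exact: lK.
pose g j := sup [set s i j - f i | i in setT].
have gub j : has_ubound [set s i j - f i | i in setT].
  exists (\sum_i `|s i j - f i|) => _ [i _ <-]; apply: le_trans (ler_norm _) _.
  by rewrite (bigD1 i)//= lerDl sumr_ge0.
have gs i j : s i j - f i <= g j by apply: ub_le_sup => //; exists i.
have gK i j : 0 < K i j -> f i + g j = s i j.
  move=> Kij; apply/eqP; rewrite eq_le; apply/andP; split; last by have := gs i j; lra.
  rewrite -lerBrDl; apply: ge_sup; first by exists (s i j - f i); exists i.
  by move=> _ [i' _ <-]; have := fK _ _ i' Kij; lra.
exists f, g; split; first by move=> i j; have := gs i j; lra.
case: (KP) => Kge Kr Kc.
have -> : \sum_i f i * r i + \sum_j g j * c j = fgain s K.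
  have -> : \sum_j g j * c j = \sum_i \sum_j g j * K i j.
    by rewrite exchange_big /=; apply: eq_bigr => j _; rewrite -mulr_sumr Kc.
  rewrite -big_split; apply: eq_bigr => i _ /=.
  rewrite -Kr mulr_sumr -big_split; apply: eq_bigr => j _ /=.
  have := Kge i j; rewrite le_eqVlt => /predU1P[<-|/gK <-]; first by rewrite !mulr0 addr0 mul0r.
  ring.
exact: K0max.
Qed.

End finite_transport.

(** * Borel functions and expectations *)

Section borel.
Context {R : realType} {n : nat}.
Local Notation V := 'rV[R]_n.

Lemma rV_open_measurable (A : set V) : open A -> measurable A.
Proof. by move=> oA; exact: sub_sigma_algebra. Qed.

Lemma rV_closed_measurable (A : set V) : closed A -> measurable A.
Proof.
by move=> /closed_openC /rV_open_measurable; rewrite -{2}[A]setCK; exact: measurableC.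
Qed.

Lemma rV_continuous_measurable (f : V -> R) :
  continuous f -> measurable_fun setT f.
Proof.
move=> /continuousP cf.
apply: (measurability _ (RGenOpens.measurableE R)) => _ [_ [x [y ->]] <-].
by rewrite setTI; apply: rV_open_measurable; apply: cf; exact: interval_open.
Qed.

Lemma enorm_le_norm (x : V) : enorm x <= Num.sqrt n%:R * `|x|.
Proof.
apply: enorm_le_sup => // j.
rewrite [`|x|]mx_normrE; apply: (le_bigmax _ (fun ij => `|x ij.1 ij.2|) (ord0, j)).
Qed.

(** The ambient topology comes from the sup norm, hence the comparison of
    norms. *)
Lemma enorm_lipschitz_continuous (f : V -> R) (C : R) :
  (forall x y, `|f x - f y| <= C * enorm (x - y)) -> continuous f.
Proof.
move=> fC x; have ? := nbhs_filter x; apply/cvgrPdist_lt => e e0.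
pose K := (`|C| * Num.sqrt n%:R + 1).
have K0 : 0 < K by rewrite ltr_wpDl// mulr_ge0// sqrtr_ge0.
apply/(@nbhs_normP R V); exists (e / K); first exact: divr_gt0.
move=> y /= xy; apply: (le_lt_trans (fC x y)).
apply: (@le_lt_trans _ _ (K * `|x - y|)).
  apply: (@le_trans _ _ (`|C| * (Num.sqrt n%:R * `|x - y|))).
    apply: (@le_trans _ _ (`|C| * enorm (x - y))).
      by rewrite ler_wpM2r ?enorm_ge0// ler_norm.
    by rewrite ler_wpM2l// enorm_le_norm.
  by rewrite mulrA ler_wpM2r// /K lerDl.
by rewrite mulrC -ltr_pdivlMr.
Qed.

Lemma enorm_lipschitz_measurable (f : V -> R) (C : R) :
  (forall x y, `|f x - f y| <= C * enorm (x - y)) -> measurable_fun setT f.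
Proof. by move=> /enorm_lipschitz_continuous; exact: rV_continuous_measurable. Qed.

Lemma eball_measurable (x : V) (r : R) : measurable (eball x r).
Proof.
have : measurable_fun setT (fun y : V => enorm (y - x)).
  apply: (@enorm_lipschitz_measurable _ 1) => y z; rewrite mul1r.
  by apply: le_trans (enorm_dist_le _ _) _; rewrite opprB addrA subrK.
move=> /(_ measurableT `]-oo, r[%classic); rewrite setTI.
have -> : eball x r = (fun y => enorm (y - x)) @^-1` `]-oo, r[.
  by apply/seteqP; split => y; rewrite /eball /= in_itv.
by apply; exact: measurable_itv.
Qed.

Context {d} {T : measurableType d}.

Lemma measurable_dotp (f g : T -> V) : measurable_fun setT f ->
  measurable_fun setT g -> measurable_fun setT (fun t => dotp (f t) (g t)).
Proof.
move=> mf mg; apply: measurable_sum => i.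
have mc : measurable_fun setT (fun x : V => x ord0 i).
  by apply: rV_continuous_measurable; exact: coord_continuous.
exact: measurable_funM (measurableT_comp mc mf) (measurableT_comp mc mg).
Qed.

Lemma measurable_enormB (f g : T -> V) : measurable_fun setT f ->
  measurable_fun setT g -> measurable_fun setT (fun t => enorm (f t - g t)).
Proof.
move=> mf mg.
have -> : (fun t => enorm (f t - g t)) = (fun t => Num.sqrt
    (dotp (f t) (f t) - dotp (f t) (g t) - dotp (f t) (g t) + dotp (g t) (g t))).
  apply/funext => t; rewrite /enorm dotpBl !dotpBr (dotpC (g t)); congr Num.sqrt.
  ring.
apply: measurableT_comp; first exact: continuous_measurable_fun (@sqrt_continuous R).
apply: measurable_funD; last exact: measurable_dotp.
by apply: measurable_funB; [apply: measurable_funB|]; exact: measurable_dotp.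
Qed.

End borel.

Section expectation.
Context {R : realType} {d} {T : measurableType d}.
Implicit Types (P : probability T R) (f g : T -> R) (A : set T).

Definition integ P f := P.-integrable setT (EFin \o f).

Lemma prob_compl0 P A : measurable A -> P A = 1%E -> P (~` A) = 0%E.
Proof. by move=> mA PA; rewrite probability_setC// PA subee. Qed.

Lemma integ_bounded P f A (C : R) : measurable A -> P A = 1%E ->
  measurable_fun setT f -> (forall x, A x -> `|f x| <= C) -> integ P f.
Proof.
move=> mA PA mf fC.
have mE : measurable_fun setT (EFin \o f) by exact/measurable_EFinP.
apply: (negligible_integrable (measurableC mA) measurableT mE (prob_compl0 mA PA)).2.
rewrite setTD setCK; apply: measurable_bounded_integrable => //.
- by rewrite -ge0_fin_numE// fin_num_measure.
- exact: measurable_funTS.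
- exists C; split; first exact: num_real.
  by move=> M CM x Ax /=; apply: le_trans (fC x Ax) (ltW CM).
Qed.

Lemma expect_on_full P A f : measurable A -> P A = 1%E -> integ P f ->
  \int[P]_(x in A) f x = \int[P]_x f x.
Proof.
move=> mA PA intf; rewrite /Rintegral.
rewrite [in RHS](negligible_integral (measurableC mA) measurableT intf (prob_compl0 mA PA)).
by rewrite setTD setCK.
Qed.

Lemma le_expect P f g A : measurable A -> P A = 1%E -> integ P f -> integ P g ->
  (forall x, A x -> f x <= g x) -> \int[P]_x f x <= \int[P]_x g x.
Proof.
move=> mA PA intf intg fg.
rewrite -!(expect_on_full mA PA)//; apply: le_Rintegral => //.
  exact: integrableS intf.
exact: integrableS intg.
Qed.

Lemma integ_cst P (c : R) : integ P (fun=> c).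
Proof. exact: finite_measure_integrable_cst. Qed.

Lemma expect_cst P (c : R) : \int[P]_x c = c.
Proof. by rewrite Rintegral_cst// [X in fine X](@probability_setT _ _ _ P) mulr1. Qed.

Lemma integD P f g : integ P f -> integ P g -> integ P (fun x => f x + g x).
Proof. by move=> i j; have := integrableD measurableT i j. Qed.

Lemma integB P f g : integ P f -> integ P g -> integ P (fun x => f x - g x).
Proof. by move=> i j; have := integrableB measurableT i j. Qed.

Lemma integZ P f (c : R) : integ P f -> integ P (fun x => c * f x).
Proof. by move=> i; have := integrableZl measurableT c i. Qed.

Lemma expectD P f g : integ P f -> integ P g ->
  \int[P]_x (f x + g x) = \int[P]_x f x + \int[P]_x g x.
Proof. exact: RintegralD. Qed.

Lemma expectB P f g : integ P f -> integ P g ->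
  \int[P]_x (f x - g x) = \int[P]_x f x - \int[P]_x g x.
Proof. exact: RintegralB. Qed.

Lemma expectZ P f (c : R) : integ P f ->
  \int[P]_x (c * f x) = c * \int[P]_x f x.
Proof. exact: RintegralZl. Qed.

Lemma EFin_expect P f : integ P f -> (\int[P]_x f x)%:E = (\int[P]_x (f x)%:E)%E.
Proof. by move=> i; rewrite fineK//; exact: integrable_fin_num i. Qed.

Lemma EFin_prob P A : measurable A -> (fine (P A))%:E = P A.
Proof. by move=> mA; rewrite fineK//; exact: fin_num_measure. Qed.

Lemma expect_sum P (I : Type) (r : seq I) (h : I -> T -> R) :
  (forall i, integ P (h i)) -> integ P (fun x => \sum_(i <- r) h i x) /\
  \int[P]_x (\sum_(i <- r) h i x) = \sum_(i <- r) \int[P]_x h i x.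
Proof.
move=> ih; elim: r => [|i r [IH1 IH2]].
  rewrite big_nil; under eq_fun do rewrite big_nil.
  by split; [exact: integ_cst|exact: expect_cst].
rewrite big_cons; under eq_fun do rewrite big_cons.
by split; [exact: integD|rewrite expectD// IH2].
Qed.

Lemma expect_indic P A : measurable A ->
  integ P (\1_A) /\ \int[P]_x (\1_A x) = fine (P A).
Proof.
move=> mA; have mi : measurable_fun setT (\1_A : T -> R) by exact: measurable_indic.
split.
  apply: (@integ_bounded _ _ setT 1) => //; first exact: probability_setT.
  by move=> x _; rewrite indicE; case: (_ \in _); rewrite ?normr1 ?normr0.
by rewrite /Rintegral integral_indic// setIT.
Qed.

Lemma expect_step P (I : finType) (u : T -> I) (c : I -> R) :
  (forall a, measurable (u @^-1` [set a])) ->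
  integ P (fun x => c (u x)) /\
  \int[P]_x c (u x) = \sum_a c a * fine (P (u @^-1` [set a])).
Proof.
move=> mu.
have E x : c (u x) = \sum_a c a * \1_(u @^-1` [set a]) x.
  rewrite (bigD1 (u x))//= indicE mem_set// mulr1.
  rewrite big1 ?addr0// => a ax; rewrite indicE memNset ?mulr0//.
  by move=> /= e; rewrite e eqxx in ax.
under eq_fun do rewrite E.
have [|i1 ->] := @expect_sum P _ (index_enum I) (fun a x => c a * \1_(u @^-1` [set a]) x).
  by move=> a; apply: integZ; exact: (expect_indic P (mu a)).1.
split=> //; apply: eq_bigr => a _; have [? h] := expect_indic P (mu a).
by rewrite expectZ// h.
Qed.

End expectation.

Lemma expect_map (R : realType) d1 d2 (T : measurableType d1)
    (U : measurableType d2) (g : probability T R) (P : probability U R)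
    (psi : T -> U) (f : U -> R) :
  measurable_fun setT psi ->
  (forall A, measurable A -> g (psi @^-1` A) = P A) ->
  measurable_fun setT f -> integ P f ->
  integ g (fun z => f (psi z)) /\ \int[g]_z f (psi z) = \int[P]_x f x.
Proof.
move=> mpsi gP mf intf.
have mE : measurable_fun setT (EFin \o f) by exact/measurable_EFinP.
have mfp : measurable_fun setT (fun z => f (psi z)) by exact: measurableT_comp.
have E (h : U -> \bar R) : (\int[pushforward g psi]_x h x = \int[P]_x h x)%E.
  by apply: eq_measure_integral => A mA _; exact: gP.
have ig : integ g (fun z => f (psi z)).
  apply/integrableP; split; first exact/measurable_EFinP.
  have := @ge0_integral_pushforward _ _ _ _ _ _ mpsi g setT (fun x => `|(f x)%:E|%E) measurableT.
  rewrite preimage_setT => <- //; first by rewrite E; case/integrableP : intf.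
  by apply: measurableT_comp.
split=> //; congr fine.
have := @integral_pushforward _ _ _ _ _ _ mpsi g setT _ mE.
by rewrite preimage_setT => <-//; rewrite E.
Qed.

Section marginals.
Context {R : realType} {d1 d2 : measure_display} {T1 : measurableType d1}
  {T2 : measurableType d2}.
Variables (P : probability T1 R) (Q : probability T2 R).
Variable g : probability (T1 * T2)%type R.
Hypothesis Pg : coupling P Q g.

Lemma coupling_fst (f : T1 -> R) : measurable_fun setT f -> integ P f ->
  integ g (fun z => f z.1) /\ \int[g]_z f z.1 = \int[P]_x f x.
Proof.
by apply: expect_map; [exact: measurable_fst|move=> A mA; rewrite -(Pg.1 A mA)].
Qed.

Lemma coupling_snd (f : T2 -> R) : measurable_fun setT f -> integ Q f ->
  integ g (fun z => f z.2) /\ \int[g]_z f z.2 = \int[Q]_x f x.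
Proof.
by apply: expect_map; [exact: measurable_snd|move=> A mA; rewrite -(Pg.2 A mA)].
Qed.

Lemma coupling_full (A : set T1) (B : set T2) : measurable A -> measurable B ->
  P A = 1%E -> Q B = 1%E -> g (A `*` B) = 1%E.
Proof.
move=> mA mB PA QB.
have mAT : measurable (A `*` [set: T2]) by exact: measurableX.
have mTB : measurable ([set: T1] `*` B) by exact: measurableX.
have gA : g (~` (fst @^-1` A)) = 0%E.
  by apply: prob_compl0; [rewrite -[X in measurable X]setTI; exact: measurable_fst|rewrite -PA -(Pg.1 A mA)].
have gB : g (~` (snd @^-1` B)) = 0%E.
  by apply: prob_compl0; [rewrite -[X in measurable X]setTI; exact: measurable_snd|rewrite -QB -(Pg.2 B mB)].
have mX : measurable (A `*` B) by exact: measurableX.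
have m1 : measurable (~` (@fst T1 T2 @^-1` A)).
  by apply: measurableC; rewrite -[X in measurable X]setTI; exact: measurable_fst.
have m2 : measurable (~` (@snd T1 T2 @^-1` B)).
  by apply: measurableC; rewrite -[X in measurable X]setTI; exact: measurable_snd.
have : g (~` (A `*` B)) = 0%E.
  apply: (subset_measure0 _ _ _ (null_set_setU m1 m2 gA gB)).
  - exact: measurableC.
  - exact: measurableU.
  - by move=> [x y] /=; rewrite -not_andP.
rewrite probability_setC// => h.
have := EFin_prob g mX; move: h; rewrite -(EFin_prob g mX) -EFinB => -[h] _.
by congr EFin; lra.
Qed.

End marginals.

Section density.
Context {R : realType} {d : measure_display} {T : measurableType d}.

(** All couplings below are obtained from densities with respect to product
    measures. *)
Lemma density_probability (mu : {measure set T -> \bar R}) (h : T -> R) :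
  measurable_fun setT h -> (forall x, 0 <= h x) ->
  (\int[mu]_x (h x)%:E)%E = 1%E ->
  exists p : probability T R,
    forall A, measurable A -> p A = (\int[mu]_(x in A) (h x)%:E)%E.
Proof.
move=> mh h0 h1.
have mE : measurable_fun setT (EFin \o h) by exact/measurable_EFinP.
pose p (A : set T) : \bar R := (\int[mu]_(x in A) (h x)%:E)%E.
have p0 : p set0 = 0%E by exact: integral_set0.
have pge0 A : (0 <= p A)%E by apply: integral_ge0 => x _; rewrite lee_fin.
have psig : semi_sigma_additive p.
  move=> F mF tF mUF; rewrite /p ge0_integral_bigcup//.
  - by apply: is_cvg_ereal_nneg_natsum => n _; exact: pge0.
  - by apply: measurable_funS mE.
  - by move=> x _; rewrite lee_fin.
pose pm : {measure set T -> \bar R} :=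
  HB.pack p (isMeasure.Build _ _ _ p p0 pge0 psig).
have pm1 : pm setT = 1%E by [].
pose pp : probability T R := HB.pack p pm (Measure_isProbability.Build _ _ _ pm pm1).
by exists pp.
Qed.

End density.

(** * Couplings with prescribed cell masses *)

Lemma prob_partition (R : realType) d (T : measurableType d)
    (P : probability T R) (I : finType) (u : T -> I) (A : set T) :
  (forall a, measurable (u @^-1` [set a])) -> measurable A ->
  \sum_a fine (P (u @^-1` [set a] `&` A)) = fine (P A).
Proof.
move=> mu mA; rewrite -(expect_indic P mA).2.
have mI a : measurable (u @^-1` [set a] `&` A) by exact: measurableI.
have E x : \1_A x = \sum_a \1_(u @^-1` [set a] `&` A) x :> R.
  rewrite (bigD1 (u x))//= big1 ?addr0 => [|a ax].
    by rewrite !indicE in_setI [x \in _ @^-1` _]mem_set.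
  rewrite indicE in_setI [x \in _ @^-1` _]memNset//= => e.
  by rewrite e eqxx in ax.
under eq_Rintegral do rewrite E.
rewrite (@expect_sum _ _ _ P _ _ (fun a x => \1_(u @^-1` [set a] `&` A) x) _).2.
  by apply: eq_bigr => a _; rewrite (expect_indic P (mI a)).2.
by move=> a; exact: (expect_indic P (mI a)).1.
Qed.

Section block.
Context {R : realType} {d1 d2 : measure_display} {T1 : measurableType d1}
  {T2 : measurableType d2}.
Variables (P : probability T1 R) (Q : probability T2 R) (I J : finType).
Variables (u : T1 -> I) (v : T2 -> J).
Hypothesis mu : forall a, measurable (u @^-1` [set a]).
Hypothesis mv : forall b, measurable (v @^-1` [set b]).
Local Notation p a := (fine (P (u @^-1` [set a]))).
Local Notation q b := (fine (Q (v @^-1` [set b]))).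
Variable K : I -> J -> R.
Hypothesis K0 : forall a b, 0 <= K a b.
Hypothesis Kp : forall a, \sum_b K a b = p a.
Hypothesis Kq : forall b, \sum_a K a b = q b.

Let c a b := K a b / (p a * q b).
Let E (ab : I * J) := (u @^-1` [set ab.1]) `*` (v @^-1` [set ab.2]).
Let h z := \sum_ab c ab.1 ab.2 * \1_(E ab) z.

Let mE ab : measurable (E ab). Proof. exact: measurableX. Qed.

Let c0 a b : 0 <= c a b.
Proof. by rewrite divr_ge0// mulr_ge0// fine_ge0. Qed.

Let Kp0 a b : p a = 0 -> K a b = 0.
Proof.
move=> pa; have := Kp a; rewrite pa => h'; exact: (psumr_eq0P (fun b _ => K0 a b) h').
Qed.

Let Kq0 a b : q b = 0 -> K a b = 0.
Proof.
move=> qb; have := Kq b; rewrite qb => h'; exact: (psumr_eq0P (fun a _ => K0 a b) h').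
Qed.

Let sum_cq a : p a != 0 -> \sum_b c a b * q b = 1.
Proof.
move=> pa; rewrite -(divff pa) -[X in _ = X / _]Kp mulr_suml; apply: eq_bigr => b _.
have [qb|qb] := eqVneq (q b) 0; first by rewrite qb mulr0 Kq0// mul0r.
by rewrite /c; field; rewrite ?pa ?qb.
Qed.

Let sum_cp b : q b != 0 -> \sum_a c a b * p a = 1.
Proof.
move=> qb; rewrite -(divff qb) -[X in _ = X / _]Kq mulr_suml; apply: eq_bigr => a _.
have [pa|pa] := eqVneq (p a) 0; first by rewrite pa mulr0 Kp0// mul0r.
by rewrite /c; field; rewrite ?pa ?qb.
Qed.

Let mh : measurable_fun setT h.
Proof.
by apply: measurable_sum => ab; apply: measurable_funM => //; exact: measurable_indic.
Qed.

Let h0 z : 0 <= h z.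
Proof. by apply: sumr_ge0 => ab _; rewrite mulr_ge0. Qed.

Let rect A B : measurable A -> measurable B ->
  (\int[(P \x Q)%E]_(z in A `*` B) (h z)%:E)%E =
  (\sum_a \sum_b c a b * (fine (P (u @^-1` [set a] `&` A))
                        * fine (Q (v @^-1` [set b] `&` B))))%:E.
Proof.
move=> mA mB; have mAB : measurable (A `*` B) by exact: measurableX.
under eq_integral do rewrite -sumEFin.
rewrite ge0_integral_sum//; last 2 first.
- move=> ab; apply/measurable_EFinP; apply: measurable_funTS.
  by apply: measurable_funM => //; exact: measurable_indic.
- by move=> ab z _; rewrite lee_fin mulr_ge0.
rewrite pair_bigA/= -sumEFin; apply: eq_bigr => -[a b] _ /=.
rewrite (integralZl_indic mAB (fun=> E (a, b)))//; last by rewrite ltNge c0.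
rewrite [RHS]EFinM; congr (_ * _)%E.
rewrite integral_indic//.
have -> : E (a, b) `&` A `*` B =
    (u @^-1` [set a] `&` A) `*` (v @^-1` [set b] `&` B).
  by apply/seteqP; split => -[x y] /=; rewrite /E /=; tauto.
have m1 : measurable (u @^-1` [set a] `&` A) by exact: measurableI.
have m2 : measurable (v @^-1` [set b] `&` B) by exact: measurableI.
by rewrite EFinM !EFin_prob//; exact: product_measure1E.
Qed.

Let marg1 A : measurable A ->
  \sum_a \sum_b c a b * (fine (P (u @^-1` [set a] `&` A)) * q b) = fine (P A).
Proof.
move=> mA; rewrite -(prob_partition P mu mA); apply: eq_bigr => a _.
have [pa|pa] := eqVneq (p a) 0.
  have -> : fine (P (u @^-1` [set a] `&` A)) = 0.
    apply/eqP; rewrite eq_le fine_ge0// andbT -pa fine_le ?fin_num_measure//.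
    - exact: measurableI.
    - by apply: le_measure; rewrite ?inE//; exact: measurableI.
  by apply: big1 => b _; rewrite mul0r mulr0.
rewrite -[RHS]mulr1 -(sum_cq pa) mulr_sumr; apply: eq_bigr => b _; ring.
Qed.

Let marg2 B : measurable B ->
  \sum_a \sum_b c a b * (p a * fine (Q (v @^-1` [set b] `&` B))) = fine (Q B).
Proof.
move=> mB; rewrite -(prob_partition Q mv mB) exchange_big; apply: eq_bigr => b _.
have [qb|qb] := eqVneq (q b) 0.
  have -> : fine (Q (v @^-1` [set b] `&` B)) = 0.
    apply/eqP; rewrite eq_le fine_ge0// andbT -qb fine_le ?fin_num_measure//.
    - exact: measurableI.
    - by apply: le_measure; rewrite ?inE//; exact: measurableI.
  by apply: big1 => a _; rewrite !mulr0.
rewrite -[RHS]mulr1 -(sum_cp qb) mulr_sumr; apply: eq_bigr => a _ /=; ring.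
Qed.

(** On each product of cells the coupling is a multiple of the product
    measure; its density is [K a b] divided by the masses of the two cells.
    A cell of mass zero forces [K a b = 0], so that the convention for the
    division by zero is harmless. *)
Lemma block_coupling : exists2 g, coupling P Q g &
  forall a b, g ((u @^-1` [set a]) `*` (v @^-1` [set b])) = (K a b)%:E.
Proof.
have [|g gE] := @density_probability R _ _ (P \x Q)%E h mh h0.
  rewrite -setXTT rect//; have := marg1 measurableT.
  rewrite [X in _ = fine X]probability_setT /= => <-; congr EFin.
  by apply: eq_bigr => a _; apply: eq_bigr => b _; rewrite [_ @^-1` [set b] `&` _]setIT.
exists g.
  split=> [A mA|B mB]; rewrite /pushforward.
  - have -> : fst @^-1` A = A `*` [set: T2] by apply/seteqP; split => -[x y] //= [].
    rewrite gE; last exact: measurableX.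
    rewrite rect// -(EFin_prob P mA) -marg1//; congr EFin.
    by apply: eq_bigr => a _; apply: eq_bigr => b _; rewrite setIT.
  - have -> : snd @^-1` B = [set: T1] `*` B by apply/seteqP; split => -[x y] //= [].
    rewrite gE; last exact: measurableX.
    rewrite rect// -(EFin_prob Q mB) -marg2//; congr EFin.
    by apply: eq_bigr => a _; apply: eq_bigr => b _; rewrite setIT.
move=> a b; rewrite gE; last exact: measurableX.
rewrite rect//; congr EFin.
rewrite (bigD1 a)//= (bigD1 b)//= !setIid big1 ?addr0; last first.
  move=> b' bb'; rewrite [X in Q X](_ : _ = set0) ?measure0 ?mulr0//.
  by apply/seteqP; split => // y /= [-> e]; rewrite e eqxx in bb'.
rewrite big1 ?addr0; last first.
  move=> a' aa'; apply: big1 => b' _.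
  rewrite [X in P X](_ : _ = set0) ?measure0 ?mul0r ?mulr0//.
  by apply/seteqP; split => // y /= [-> e]; rewrite e eqxx in aa'.
have [pa|pa] := eqVneq (p a) 0; first by rewrite pa mul0r mulr0 Kp0.
have [qb|qb] := eqVneq (q b) 0; first by rewrite qb !mulr0 Kq0.
by rewrite /c; field; rewrite ?pa ?qb.
Qed.

End block.

(** Both expectations are compared with that of [c], a function of the cell,
    which the two measures integrate alike. This controls all discretization
    errors. *)
Lemma expect_cells_le (R : realType) d d' (T : measurableType d)
    (T' : measurableType d') (p : probability T R) (p' : probability T' R)
    (I : finType) (u : T -> I) (u' : T' -> I) (c : I -> R) (w : R)
    (A : set T) (A' : set T') (F : T -> R) (G : T' -> R) :
  (forall a, measurable (u @^-1` [set a])) ->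
  (forall a, measurable (u' @^-1` [set a])) ->
  (forall a, p (u @^-1` [set a]) = p' (u' @^-1` [set a])) ->
  measurable A -> p A = 1%E -> measurable A' -> p' A' = 1%E ->
  integ p F -> integ p' G ->
  (forall z, A z -> F z <= c (u z)) ->
  (forall z, A' z -> c (u' z) <= G z + w) ->
  \int[p]_z F z <= \int[p']_z G z + w.
Proof.
move=> mu mu' pp mA pA mA' pA' iF iG Fc cG.
have [i1 e1] := expect_step p c mu; have [i2 e2] := expect_step p' c mu'.
apply: (@le_trans _ _ (\int[p]_z c (u z))); first exact: (le_expect mA pA).
have -> : \int[p]_z c (u z) = \int[p']_z c (u' z).
  by rewrite e1 e2; apply: eq_bigr => a _; rewrite pp.
rewrite -[X in _ + X](expect_cst p' w) -expectD//; last exact: integ_cst.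
apply: (le_expect mA' pA') => //; apply: integD => //; exact: integ_cst.
Qed.

Section cells.
Context {R : realType} {n : nat}.
Local Notation V := 'rV[R]_n.

Lemma eball_open (x : V) (r : R) : open (eball x r).
Proof.
have /continuousP c : continuous (fun y : V => enorm (y - x)).
  apply: (@enorm_lipschitz_continuous _ _ _ 1) => y z; rewrite mul1r.
  by apply: le_trans (enorm_dist_le _ _) _; rewrite opprB addrA subrK.
have -> : eball x r = (fun y => enorm (y - x)) @^-1` `]-oo, r[.
  by apply/seteqP; split => y; rewrite /eball /= in_itv.
by apply: c; exact: interval_open.
Qed.

(** The cell of [x] is the index of the first ball of a finite cover that
    contains [x]; the last cell collects the points outside the cover. *)
Lemma compact_cells (X : set V) (e : R) : compact X -> X !=set0 -> 0 < e ->
  exists (m : nat) (u : V -> 'I_m.+1) (c : 'I_m.+1 -> V),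
    [/\ forall a, measurable (u @^-1` [set a]), forall a, X (c a) &
        forall x, X x -> enorm (x - c (u x)) < e].
Proof.
move=> cX [x0 Xx0] e0.
move: (cX); rewrite compact_cover => /(_ V X (fun c => eball c e)) [||D DX DXe].
- by move=> c _; exact: eball_open.
- by move=> x Xx; exists x => //; rewrite /eball /= subrr enorm0.
pose s : seq V := finmap.enum_fset D.
have sX c : c \in s -> X c by move=> cs; have := DX c cs; rewrite inE.
pose f (x : V) := find (fun c => enorm (x - c) < e) s.
have fs x : (f x < (size s).+1)%N by rewrite ltnS find_size.
pose u (x : V) : 'I_(size s).+1 := Ordinal (fs x).
exists (size s), u, (fun a => nth x0 s a); split.
- move=> a.
  have -> : u @^-1` [set a] = [set x | f x = a].
    by apply/seteqP; split => x /=; [move=> <-|move=> fx; exact/val_inj].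
  rewrite /f; move: (nat_of_ord a); move: s {sX f fs u a}.
  elim=> [|c s IH] [|k] /=.
  + by rewrite (_ : [set x | _] = setT)//; apply/seteqP; split.
  + by rewrite (_ : [set x | _] = set0)//; apply/seteqP; split.
  + rewrite (_ : [set x | _] = eball c e); first exact: eball_measurable.
    apply/seteqP; split => x /=; rewrite /eball /=; first by case: ifP.
    by move=> ->.
  + rewrite (_ : [set x | _] = ~` eball c e `&`
       [set x | find (fun c => enorm (x - c) < e) s = k]).
      by apply: measurableI => //; apply: measurableC; exact: eball_measurable.
    apply/seteqP; split => x /=; rewrite /eball /=.
      by case: ifP => // xc [].
    by move=> [/negP/negbTE -> ->].
- move=> a; have [as_|as_] := ltnP a (size s); first by apply: sX; exact: mem_nth.
  by rewrite nth_default.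
- move=> x Xx /=.
  have hx : has (fun c => enorm (x - c) < e) s.
    by have [c cD xc] := DXe x Xx; apply/hasP; exists c.
  exact: (nth_find x0 hx).
Qed.

End cells.

(** * Almost optimal potentials *)

Section affine_sup.
Context {R : realType} {n : nat} {I : Type}.
Local Notation V := 'rV[R]_n.
Variables (S : set I) (p : I -> V) (b : I -> R) (C B : R).
Hypothesis S0 : S !=set0.
Hypothesis pC : forall i, S i -> enorm (p i) <= C.
Hypothesis bB : forall i, S i -> B <= b i.

(** Both potentials of the transport problem have this form: one with a
    finite family [p] of points, its conjugate with [p] the identity of the
    target set. *)
Definition affine_sup x := sup [set dotp x (p i) - b i | i in S].

Let ub x : has_ubound [set dotp x (p i) - b i | i in S].
Proof.
exists (enorm x * C - B) => _ [i Si <-]; apply: lerB; last exact: bB.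
by apply: le_trans (cauchy_schwarz _ _) _; rewrite ler_wpM2l ?enorm_ge0// pC.
Qed.

Lemma affine_sup_ge x i : S i -> dotp x (p i) - b i <= affine_sup x.
Proof. by move=> Si; apply: ub_le_sup => //; exists i. Qed.

Lemma affine_sup_le x a : (forall i, S i -> dotp x (p i) - b i <= a) ->
  affine_sup x <= a.
Proof.
move=> H; apply: ge_sup; first by have [i Si] := S0; exists (dotp x (p i) - b i), i.
by move=> _ [i Si <-]; exact: H.
Qed.

Lemma affine_sup_cvx : is_cvx affine_sup.
Proof.
move=> x y t /andP[t0 t1]; apply: affine_sup_le => i Si.
rewrite dotpDl !dotpZl.
have h1 := affine_sup_ge x Si; have h2 := affine_sup_ge y Si.
have : t * (dotp x (p i) - b i) <= t * affine_sup x by rewrite ler_wpM2l.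
have : (1 - t) * (dotp y (p i) - b i) <= (1 - t) * affine_sup y.
  by rewrite ler_wpM2l// subr_ge0.
lra.
Qed.

Lemma affine_sup_lipschitz x y : `|affine_sup x - affine_sup y| <= C * enorm (x - y).
Proof.
have H u v : affine_sup u <= affine_sup v + C * enorm (u - v).
  apply: affine_sup_le => i Si; have := affine_sup_ge v Si.
  have : dotp (u - v) (p i) <= C * enorm (u - v).
    apply: le_trans (cauchy_schwarz _ _) _.
    by rewrite mulrC ler_wpM2r ?enorm_ge0// pC.
  rewrite dotpBl; lra.
have := H x y; have := H y x; rewrite (enormB y x) ler_norml; lra.
Qed.

Lemma affine_sup_slope (lo D : R) j : (forall i, S i -> lo <= p i ord0 j <= lo + D) ->
  forall x t, 0 <= t ->
    lo * t <= affine_sup (x + t *: delta_mx ord0 j) - affine_sup x <= (lo + D) * t.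
Proof.
move=> Hlo x t t0; apply/andP; split.
  suff : affine_sup x <= affine_sup (x + t *: delta_mx ord0 j) - lo * t by lra.
  apply: affine_sup_le => i Si.
  have := affine_sup_ge (x + t *: delta_mx ord0 j) Si.
  rewrite dotpDl dotpZl dotp_delta; have /andP[h1 h2] := Hlo i Si.
  have : lo * t <= t * p i ord0 j by rewrite mulrC ler_wpM2l.
  lra.
rewrite lerBlDl; apply: affine_sup_le => i Si.
have := affine_sup_ge x Si.
rewrite dotpDl dotpZl dotp_delta; have /andP[h1 h2] := Hlo i Si.
have : t * p i ord0 j <= (lo + D) * t by rewrite mulrC ler_wpM2r.
lra.
Qed.

End affine_sup.

Section compact_sets.
Context {R : realType} {n : nat}.
Local Notation V := 'rV[R]_n.
Variable X : set V.
Hypothesis cX : compact X.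

Lemma set_radius_ge x : X x -> enorm x <= set_radius X.
Proof.
move=> Xx; apply: ub_le_sup; last by exists x.
have [M [_ HM]] := compact_bounded cX.
exists (Num.sqrt n%:R * (`|M| + 1)) => _ [y Xy <-].
apply: le_trans (enorm_le_norm y) _; rewrite ler_wpM2l ?sqrtr_ge0//.
by apply: HM => //; rewrite (le_lt_trans (ler_norm M))// ltrDl.
Qed.

Lemma set_diam_ge x y : X x -> X y -> enorm (x - y) <= set_diam X.
Proof.
move=> Xx Xy; apply: ub_le_sup; last by exists x => //; exists y.
exists (set_radius X + set_radius X) => _ [u Xu [v Xv <-]].
apply: le_trans (enorm_triangle _ _) _; rewrite enormN.
by apply: lerD; exact: set_radius_ge.
Qed.

Lemma compact_rV_measurable : measurable X.
Proof.
by apply: rV_closed_measurable; apply: compact_closed => //; exact: norm_hausdorff.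
Qed.

End compact_sets.

Section plans.
Context {R : realType} {n : nat}.
Local Notation V := 'rV[R]_n.
Variables (X Y : set V) (rho mu : probability V R).
Hypotheses (cX : compact X) (cY : compact Y).
Hypotheses (rhoX : rho X = 1%E) (muY : mu Y = 1%E).
Let mX := compact_rV_measurable cX.
Let mY := compact_rV_measurable cY.
Local Notation RX := (set_radius X).
Local Notation RY := (set_radius Y).

Lemma full_nonempty : X !=set0.
Proof.
apply/set0P/negP => /eqP X0; move: rhoX; rewrite X0 measure0 => -[] /esym/eqP.
by rewrite oner_eq0.
Qed.

Lemma integ_compact (f : V -> R) (C : R) : measurable_fun setT f ->
  (forall x, X x -> `|f x| <= C) -> integ rho f.
Proof. by move=> mf fC; exact: (integ_bounded mX rhoX mf fC). Qed.

Lemma integ_lipschitz (f : V -> R) (C : R) :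
  (forall x y, `|f x - f y| <= C * enorm (x - y)) -> integ rho f.
Proof.
move=> fC; have [x0 X0] := full_nonempty.
apply: (@integ_compact _ (`|f x0| + `|C| * set_diam X)).
  exact: enorm_lipschitz_measurable fC.
move=> x Xx; rewrite -[f x](subrK (f x0)) (le_trans (ler_normD _ _))// addrC lerD2l.
apply: le_trans (fC _ _) _; apply: (@le_trans _ _ (`|C| * enorm (x - x0))).
  by rewrite ler_wpM2r ?enorm_ge0// ler_norm.
by rewrite ler_wpM2l// set_diam_ge.
Qed.

Lemma integ_dotp_self : integ rho (fun x => dotp x x).
Proof.
apply: (@integ_compact _ (RX ^+ 2)).
  by apply: measurable_dotp; exact: measurable_id.
move=> x Xx; rewrite ger0_norm ?dotp_ge0// -enorm_sqr.
rewrite ler_pXn2r ?nnegrE ?enorm_ge0 ?set_radius_ge//.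
by apply: le_trans (enorm_ge0 x) _; exact: set_radius_ge.
Qed.

Lemma radius_ge0 : 0 <= RX.
Proof.
by have [x Xx] := full_nonempty; apply: le_trans (enorm_ge0 x) (set_radius_ge cX Xx).
Qed.

Lemma diam_ge0 : 0 <= set_diam X.
Proof.
by have [x Xx] := full_nonempty; apply: le_trans (enorm_ge0 (x - x)) (set_diam_ge cX Xx Xx).
Qed.

End plans.

Section duality.
Context {R : realType} {n : nat}.
Local Notation V := 'rV[R]_n.
Variables (X Y : set V) (rho mu : probability V R).
Hypotheses (cX : compact X) (cY : compact Y).
Hypotheses (rhoX : rho X = 1%E) (muY : mu Y = 1%E).
Let mX := compact_rV_measurable cX.
Let mY := compact_rV_measurable cY.
Local Notation RX := (set_radius X).
Local Notation RY := (set_radius Y).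
Let mXY : measurable (X `*` Y). Proof. exact: measurableX. Qed.

Lemma dotp_bound x y : X x -> Y y -> `|dotp x y| <= RX * RY.
Proof.
move=> Xx Yy; apply: le_trans (norm_dotp_le _ _) _.
by apply: ler_pM; rewrite ?enorm_ge0 ?set_radius_ge.
Qed.

Lemma integ_dotp (g : probability (V * V)%type R) : coupling rho mu g ->
  integ g (fun z => dotp z.1 z.2).
Proof.
move=> gc; apply: (integ_bounded mXY (coupling_full gc mX mY rhoX muY)).
  by apply: measurable_dotp; [exact: measurable_fst|exact: measurable_snd].
by move=> z [? ?]; exact: dotp_bound.
Qed.

Lemma quadratic_costE (g : probability (V * V)%type R) : coupling rho mu g ->
  quadratic_cost g = (\int[rho]_x dotp x x + \int[mu]_y dotp y y
                      - 2 * \int[g]_z dotp z.1 z.2)%:E.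
Proof.
move=> gc.
have ms : measurable_fun setT (fun x : V => dotp x x).
  by apply: measurable_dotp; exact: measurable_id.
have [i1 <-] := coupling_fst gc ms (integ_dotp_self cX rhoX).
have [i2 <-] := coupling_snd gc ms (integ_dotp_self cY muY).
have i3 := integ_dotp gc.
rewrite -expectD// -expectZ// -expectB; [|exact: integD|exact: integZ].
rewrite EFin_expect; last by apply: integB; [exact: integD|exact: integZ].
apply: eq_integral => z _; congr EFin.
by rewrite enorm_sqr dotpBl !dotpBr (dotpC z.2 z.1); ring.
Qed.

Lemma optimal_dotp g g' : optimal_plan rho mu g -> coupling rho mu g' ->
  \int[g']_z dotp z.1 z.2 <= \int[g]_z dotp z.1 z.2.
Proof.
move=> [gc gopt] gc'; have := gopt _ gc'.
rewrite !quadratic_costE// lee_fin; lra.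
Qed.

(** The Legendre transform of [psi] relative to [Y]. *)
Definition potential (psi : V -> R) := affine_sup Y id psi.

(** Discretize the plan [g] on small cells. Every finite plan with the same
    marginals is realised by a competitor of [g], so the discretized plan is
    almost maximal, and [finite_duality] gives finite potentials. The upper
    envelope [psi] of the affine functions that they define is Lipschitz,
    and neither passing to the envelope nor undoing the discretization costs
    more than the size of the cells. *)
Lemma approximate_duality g (tau : R) : optimal_plan rho mu g -> 0 < tau ->
  exists psi : V -> R,
    (forall y y', `|psi y - psi y'| <= RX * enorm (y - y')) /\
    \int[rho]_x potential psi x + \int[mu]_y psi y
      <= \int[g]_z dotp z.1 z.2 + tau.
Proof.
move=> gopt tau0; have gc := gopt.1.
have RX0 := radius_ge0 cX rhoX; have RY0 := radius_ge0 cY muY.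
have X0 := full_nonempty rhoX; have Y0 := full_nonempty muY.
pose e := tau / (4 * (RX + RY + 1)).
have e0 : 0 < e by rewrite divr_gt0// mulr_gt0// ltr_wpDl// addr_ge0.
pose w := e * (RX + RY).
have wtau : 4 * w <= tau.
  have -> : tau = 4 * (e * (RX + RY + 1)) by rewrite /e; field; lra.
  by rewrite ler_pM2l// /w ler_pM2l//; lra.
have [m [u [c [mu_ cX' ce]]]] := compact_cells cX X0 e0.
have [m' [v [c' [mv_ cY' ce']]]] := compact_cells cY Y0 e0.
pose s a b := dotp (c a) (c' b).
pose r a := fine (rho (u @^-1` [set a])).
pose q b := fine (mu (v @^-1` [set b])).
pose cell a b := (u @^-1` [set a]) `*` (v @^-1` [set b]).
pose K0 a b := fine (g (cell a b)).
pose uv (z : V * V) := (u z.1, v z.2).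
have uvE a b : uv @^-1` [set (a, b)] = cell a b.
  apply/seteqP; split => [[x y]|[x y]]; rewrite /uv /cell /=; first by move=> [<- <-].
  by move=> [-> ->].
have muv ab : measurable (uv @^-1` [set ab]).
  by case: ab => a b; rewrite uvE; exact: measurableX.
have sw x y : X x -> Y y -> `|dotp x y - s (u x) (v y)| <= w.
  move=> Xx Yy; rewrite /s.
  have -> : dotp x y - dotp (c (u x)) (c' (v y)) =
     dotp (x - c (u x)) y + dotp (c (u x)) (y - c' (v y)).
    by rewrite dotpBl dotpBr; ring.
  apply: le_trans (ler_normD _ _) _; rewrite /w mulrDr addrC.
  apply: lerD; apply: le_trans (norm_dotp_le _ _) _.
    rewrite mulrC; apply: ler_pM; rewrite ?enorm_ge0 ?set_radius_ge// ltW//.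
    exact: ce'.
  by apply: ler_pM; rewrite ?enorm_ge0 ?set_radius_ge// ltW// ce.
have gXY h : coupling rho mu h -> h (X `*` Y) = 1%E.
  by move=> hc; exact: (coupling_full hc mX mY).
have gainE (h : probability (V * V)%type R) :
    fgain s (fun a b => fine (h (cell a b))) = \int[h]_z s (uv z).1 (uv z).2.
  have [_ ->] := expect_step h (fun ab => s ab.1 ab.2) muv.
  rewrite /fgain pair_bigA; apply: eq_bigr => -[a b] _ /=.
  by rewrite uvE mulrC.
have is_ (h : probability (V * V)%type R) : integ h (fun z => s (uv z).1 (uv z).2).
  exact: (expect_step h (fun ab => s ab.1 ab.2) muv).1.
have gain_le h : coupling rho mu h ->
    fgain s (fun a b => fine (h (cell a b))) <= \int[h]_z dotp z.1 z.2 + w.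
  move=> hc; rewrite gainE -(expect_cst h w) -expectD; [|exact: integ_dotp|exact: integ_cst].
  apply: (le_expect mXY (gXY h hc)) => //.
    by apply: integD; [exact: integ_dotp|exact: integ_cst].
  by move=> [x y] [Xx Yy] /=; have := sw x y Xx Yy; rewrite ler_norml /=; lra.
have le_gain : \int[g]_z dotp z.1 z.2 <= fgain s K0 + w.
  rewrite /K0 gainE -(expect_cst g w) -expectD//; last exact: integ_cst.
  apply: (le_expect mXY (gXY g gc)) => //; first exact: integ_dotp.
    by apply: integD => //; exact: integ_cst.
  by move=> [x y] [Xx Yy] /=; have := sw x y Xx Yy; rewrite ler_norml /=; lra.
have K0P : fplan r q K0.
  split=> [a b|a|b]; first by rewrite fine_ge0.
  - rewrite /r -(gc.1 _ (mu_ a)) /pushforward.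
    rewrite -(@prob_partition _ _ _ g _ (v \o snd)) => [|b|].
    + apply: eq_bigr => b _; rewrite /K0.
      suff -> : cell a b = (v \o snd) @^-1` [set b] `&` fst @^-1` (u @^-1` [set a]) by [].
      by apply/seteqP; split => -[x y] /=; rewrite /cell /=; tauto.
    + by rewrite comp_preimage -[X in measurable X]setTI; exact: measurable_snd.
    + by rewrite -[X in measurable X]setTI; exact: measurable_fst.
  - rewrite /q -(gc.2 _ (mv_ b)) /pushforward.
    rewrite -(@prob_partition _ _ _ g _ (u \o fst)) => [|a|].
    + apply: eq_bigr => a _; rewrite /K0.
      suff -> : cell a b = (u \o fst) @^-1` [set a] `&` snd @^-1` (v @^-1` [set b]) by [].
      by apply/seteqP; split => -[x y] /=; rewrite /cell /=; tauto.
    + by rewrite comp_preimage -[X in measurable X]setTI; exact: measurable_fst.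
    + by rewrite -[X in measurable X]setTI; exact: measurable_snd.
have K0opt K : fplan r q K -> fgain s K <= fgain s K0 + (w + w).
  move=> [KK Kr Kq].
  have [h hc hK] := block_coupling mu_ mv_ KK Kr Kq.
  have -> : fgain s K = fgain s (fun a b => fine (h (cell a b))).
    by apply: eq_bigr => a _; apply: eq_bigr => b _; rewrite hK.
  have := gain_le h hc; have := optimal_dotp gopt hc; have := le_gain; lra.
have [f [k [fk fkK0]]] := finite_duality K0P K0opt.
have cC a : [set: 'I_m.+1] a -> enorm (c a) <= RX by move=> _; exact: set_radius_ge.
pose B := - \sum_a `|f a|.
have fB a : [set: 'I_m.+1] a -> B <= f a.
  move=> _; rewrite /B lerNl; apply: le_trans (_ : `|f a| <= _).
    by rewrite -normrN ler_norm.
  by rewrite (bigD1 a)//= lerDl sumr_ge0.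
have I0 : [set: 'I_m.+1] !=set0 by exists ord0.
pose psi := affine_sup [set: 'I_m.+1] c f.
have psiL := affine_sup_lipschitz I0 cC fB.
exists psi; split=> //.
have [y0 Yy0] := Y0.
have YC y : Y y -> enorm y <= RY by exact: set_radius_ge.
pose B' := psi y0 - RX * set_diam Y.
have psiB y : Y y -> B' <= psi y.
  move=> Yy; have := psiL y y0; rewrite ler_norml => /andP[h _].
  have : RX * enorm (y - y0) <= RX * set_diam Y by rewrite ler_wpM2l// set_diam_ge.
  by rewrite /B' /psi; lra.
have phiL := affine_sup_lipschitz (p := id) Y0 YC psiB.
have phic a : potential psi (c a) <= f a.
  apply: affine_sup_le => // y Yy.
  have := affine_sup_ge cC fB y (i := a) Logic.I; rewrite -/psi dotpC /=; lra.
have psic b : psi (c' b) <= k b.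
  by apply: affine_sup_le => // a _; have := fk a b; rewrite /s dotpC; lra.
have iphi : integ rho (potential psi) by exact: (integ_lipschitz cX rhoX phiL).
have ipsi : integ mu psi by exact: (integ_lipschitz cY muY psiL).
have H1 : \int[rho]_x potential psi x <= \sum_a f a * r a + RY * e.
  have [if_ <-] := expect_step rho f mu_.
  rewrite -[X in _ + X](expect_cst rho) -expectD//; last exact: integ_cst.
  apply: (le_expect mX rhoX) => //; first by apply: integD => //; exact: integ_cst.
  move=> x Xx; have := phiL x (c (u x)); rewrite ler_norml => /andP[_ h].
  have := phic (u x).
  have : RY * enorm (x - c (u x)) <= RY * e by rewrite ler_wpM2l// ltW// ce.
  by rewrite /potential in iphi *; lra.
have H2 : \int[mu]_y psi y <= \sum_b k b * q b + RX * e.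
  have [ik <-] := expect_step mu k mv_.
  rewrite -[X in _ + X](expect_cst mu) -expectD//; last exact: integ_cst.
  apply: (le_expect mY muY) => //; first by apply: integD => //; exact: integ_cst.
  move=> y Yy; have := psiL y (c' (v y)); rewrite ler_norml => /andP[_ h].
  have := psic (v y).
  have : RX * enorm (y - c' (v y)) <= RX * e by rewrite ler_wpM2l// ltW// ce'.
  by rewrite /psi; lra.
have := gain_le g gc; rewrite -/K0 => h3.
have wE : w = RX * e + RY * e by rewrite /w; ring.
lra.
Qed.

End duality.

Section potential.
Context {R : realType} {n : nat}.
Local Notation V := 'rV[R]_n.
Variables (Y : set V) (mu : probability V R) (psi : V -> R) (L : R).
Hypotheses (cY : compact Y) (Y0 : Y !=set0).
Hypothesis psiL : forall y y', `|psi y - psi y'| <= L * enorm (y - y').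
Hypothesis L0 : 0 <= L.

Let YC y : Y y -> enorm y <= set_radius Y. Proof. exact: set_radius_ge. Qed.

Let psi_lb : exists B, forall y, Y y -> B <= psi y.
Proof.
have [y0 Yy0] := Y0; exists (psi y0 - L * set_diam Y) => y Yy.
have := psiL y y0; rewrite ler_norml => /andP[h _].
have : L * enorm (y - y0) <= L * set_diam Y by rewrite ler_wpM2l// set_diam_ge.
lra.
Qed.

Lemma potential_cvx : is_cvx (potential Y psi).
Proof. by have [B hB] := psi_lb; exact: (affine_sup_cvx Y0 YC hB). Qed.

Lemma potential_lipschitz x x' :
  `|potential Y psi x - potential Y psi x'| <= set_radius Y * enorm (x - x').
Proof. by have [B hB] := psi_lb; exact: (affine_sup_lipschitz Y0 YC hB). Qed.

Lemma potential_fenchel x y : Y y -> dotp x y <= potential Y psi x + psi y.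
Proof.
move=> Yy; have [B hB] := psi_lb.
by have := affine_sup_ge YC hB x Yy; rewrite -/(potential Y psi) /potential /=; lra.
Qed.

Lemma potential_slope (j : 'I_n) : exists lo : R, forall x t, 0 <= t ->
  lo * t <= potential Y psi (x + t *: delta_mx ord0 j) - potential Y psi x
         <= (lo + set_diam Y) * t.
Proof.
have [B hB] := psi_lb; pose S := [set y ord0 j | y in Y].
have S0 : S !=set0 by have [y Yy] := Y0; exists (y ord0 j), y.
have dj y y' : Y y -> Y y' -> y ord0 j <= y' ord0 j + set_diam Y.
  move=> Yy Yy'; rewrite -lerBlDl; apply: le_trans (set_diam_ge cY Yy Yy').
  apply: le_trans (enorm_coord (y - y') j); rewrite !mxE; exact: ler_norm.
exists (inf S); apply: (affine_sup_slope Y0 YC hB) => y Yy /=.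
apply/andP; split.
  apply: ge_inf; last by exists y.
  by exists (y ord0 j - set_diam Y) => _ [y' Yy' <-]; have := dj _ _ Yy Yy'; lra.
rewrite -lerBlDr; apply: lb_le_inf => // _ [y' Yy' <-].
by have := dj _ _ Yy Yy'; lra.
Qed.

(** Let [v] have length [eta] and the direction of [y1 - y0]. The affine
    function of slope [y1], lowered by its gap at [x], minorizes the
    potential at [x + v]; that of slope [y0] does so at [x - v]. In the sum
    of the two minorations the linear terms add up to [eta * enorm (y1 -
    y0)]. *)
Lemma gap_le_diff2 x y0 y1 (eta : R) : 0 < eta -> Y y0 -> Y y1 ->
  exists2 v, enorm v <= eta &
  eta * enorm (y0 - y1) <= (potential Y psi x + psi y0 - dotp x y0)
    + (potential Y psi x + psi y1 - dotp x y1) + diff2 (potential Y psi) v x.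
Proof.
move=> eta0 Yy0 Yy1; pose D := enorm (y1 - y0).
exists ((eta / D) *: (y1 - y0)).
  have [D0|D0] := eqVneq D 0; first by rewrite D0 invr0 mulr0 scale0r enorm0 ltW.
  have D1 : 0 < D by rewrite lt_neqAle eq_sym D0 enorm_ge0.
  by rewrite enormZ gtr0_norm ?divr_gt0// -/D divfK.
set v := _ *: _.
have vE : dotp v (y1 - y0) = eta * enorm (y0 - y1).
  rewrite /v dotpZl -enorm_sqr -/D (enormB y0) -/D.
  have [->|D0] := eqVneq D 0; first by rewrite expr0n/= !mulr0.
  by field.
have h1 := potential_fenchel (x + v) Yy1; have h2 := potential_fenchel (x - v) Yy0.
rewrite -vE /diff2 dotpBr; rewrite dotpDl in h1; rewrite dotpBl in h2.
lra.
Qed.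

End potential.

(** * Approximate gluing of plans *)

Section gluing.
Context {R : realType} {n : nat}.
Local Notation V := 'rV[R]_n.
Variables (X : set V) (rho0 rho1 mu0 mu1 : probability V R).
Hypotheses (cX : compact X) (rho0X : rho0 X = 1%E) (rho1X : rho1 X = 1%E).
Variables (g0 g1 : probability (V * V)%type R).
Hypotheses (g0c : coupling rho0 mu0 g0) (g1c : coupling rho1 mu1 g1).
Let mX := compact_rV_measurable cX.

Lemma integ_dist (s : probability (V * V)%type R) : coupling rho0 rho1 s ->
  integ s (fun z => enorm (z.1 - z.2)).
Proof.
move=> sc.
have mXX : measurable (X `*` X) by exact: measurableX.
apply: (integ_bounded mXX (coupling_full sc mX mX rho0X rho1X) (C := set_diam X)).
  by apply: measurable_enormB; [exact: measurable_fst|exact: measurable_snd].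
by move=> z [? ?]; rewrite ger0_norm ?enorm_ge0// set_diam_ge.
Qed.

(** On small cells the two plans are combined independently, which dispenses
    with the disintegration of measures; the first coordinates are known up
    to the size of the cells, and the masses of the pairs of cells are those
    of [s]. *)
Lemma approximate_gluing (s : probability (V * V)%type R) (e : R) :
  coupling rho0 rho1 s -> 0 < e ->
  exists2 p, coupling g0 g1 p &
    \int[p]_z enorm (z.1.1 - z.2.1) <= \int[s]_z enorm (z.1 - z.2) + e.
Proof.
move=> sc e0; have X0 := full_nonempty rho0X.
have e4 : 0 < e / 4 by rewrite divr_gt0.
have [m [u [c [mu_ cX' ce]]]] := compact_cells cX X0 e4.
pose K a b := fine (s ((u @^-1` [set a]) `*` (u @^-1` [set b]))).
have mc1 a : measurable ((u \o fst) @^-1` [set a] : set (V * V)).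
  by rewrite comp_preimage -[X in measurable X]setTI; exact: measurable_fst.
have mc2 a : measurable ((u \o snd) @^-1` [set a] : set (V * V)).
  by rewrite comp_preimage -[X in measurable X]setTI; exact: measurable_snd.
have [a b|a|b|p pc pK] := @block_coupling _ _ _ _ _ g0 g1 _ _ (u \o fst) (u \o fst)
    mc1 mc1 K.
- by rewrite fine_ge0.
- rewrite [X in fine X](g0c.1 _ (mu_ a)) -(sc.1 _ (mu_ a)) /pushforward.
  rewrite -(@prob_partition _ _ _ s _ (u \o snd)) => [||//]; last 2 first.
  + exact: mc2.
  + exact: mc1.
  apply: eq_bigr => b _; rewrite /K.
  suff -> : u @^-1` [set a] `*` u @^-1` [set b] =
    (u \o snd) @^-1` [set b] `&` fst @^-1` (u @^-1` [set a]) by [].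
  by apply/seteqP; split => -[x y] /=; tauto.
- rewrite [X in fine X](g1c.1 _ (mu_ b)) -(sc.2 _ (mu_ b)) /pushforward.
  rewrite -(@prob_partition _ _ _ s _ (u \o fst)) => [||//]; last 2 first.
  + exact: mc1.
  + exact: mc2.
  apply: eq_bigr => a _; rewrite /K.
  suff -> : u @^-1` [set a] `*` u @^-1` [set b] =
    (u \o fst) @^-1` [set a] `&` snd @^-1` (u @^-1` [set b]) by [].
  by apply/seteqP; split => -[x y] /=; tauto.
exists p => //.
pose v (z : (V * V) * (V * V)) := (u z.1.1, u z.2.1).
pose v' (z : V * V) := (u z.1, u z.2).
have vE a b : v @^-1` [set (a, b)] = ((u \o fst) @^-1` [set a]) `*` ((u \o fst) @^-1` [set b]).
  apply/seteqP; split => [[x y]|[x y]]; rewrite /v /=; first by move=> [<- <-].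
  by move=> [-> ->].
have v'E a b : v' @^-1` [set (a, b)] = (u @^-1` [set a]) `*` (u @^-1` [set b]).
  apply/seteqP; split => [[x y]|[x y]]; rewrite /v' /=; first by move=> [<- <-].
  by move=> [-> ->].
have mXT : measurable (X `*` [set: V]) by exact: measurableX.
have g0X : g0 (X `*` [set: V]) = 1%E.
  by apply: (coupling_full g0c) => //; exact: probability_setT.
have g1X : g1 (X `*` [set: V]) = 1%E.
  by apply: (coupling_full g1c) => //; exact: probability_setT.
have mXX : measurable (X `*` X) by exact: measurableX.
have mXTX : measurable ((X `*` [set: V]) `*` (X `*` [set: V])) by exact: measurableX.
have pX := coupling_full pc mXT mXT g0X g1X.
apply: (@expect_cells_le _ _ _ _ _ p s _ v v'
  (fun ab => enorm (c ab.1 - c ab.2) + e / 2) e _ _ _ _ _ _ _ mXTX _ mXX _ _ _ _ _).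
- by move=> [a b]; rewrite vE; exact: measurableX.
- by move=> [a b]; rewrite v'E; exact: measurableX.
- move=> [a b]; rewrite vE v'E [LHS]pK /K EFin_prob//; exact: measurableX.
- exact: pX.
- exact: (coupling_full sc).
- apply: (integ_bounded mXTX pX (C := set_diam X)).
    apply: measurable_enormB; exact: (measurableT_comp measurable_fst).
  by move=> z [[? _] [? _]]; rewrite ger0_norm ?enorm_ge0// set_diam_ge.
- exact: integ_dist.
- move=> z [[X1 _] [X2 _]] /=.
  have := ce _ X1; have := ce _ X2.
  have := enorm_distD (c (u z.1.1)) z.1.1 z.2.1.
  have := enorm_distD (c (u z.2.1)) (c (u z.1.1)) z.2.1.
  rewrite (enormB (c (u z.2.1)) z.2.1); lra.
- move=> z [X1 X2] /=.
  have := ce _ X1; have := ce _ X2.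
  have := enorm_distD z.1 (c (u z.1)) (c (u z.2)).
  have := enorm_distD z.2 z.1 (c (u z.2)).
  rewrite (enormB (c (u z.1)) z.1); lra.
Qed.

(** The block coupling with a single cell. *)
Lemma product_coupling : exists s, coupling rho0 rho1 s.
Proof.
have mT (a : unit) : measurable ((fun=> tt) @^-1` [set a] : set V).
  by case: a; rewrite (_ : _ @^-1` _ = setT)//; apply/seteqP; split.
have E (P : probability V R) a : fine (P ((fun=> tt) @^-1` [set a])) = 1.
  case: a; rewrite [X in P X](_ : _ = setT); last by apply/seteqP; split.
  by rewrite [X in fine X]probability_setT.
have K1 (P : probability V R) (a : unit) :
    \sum_(b : unit) 1 = fine (P ((fun=> tt) @^-1` [set a])) :> R.
  by rewrite E (big_pred1 tt)// => -[].
have [s sc _] := block_coupling mT mT (fun _ _ => ler01) (K1 rho0) (K1 rho1).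
by exists s.
Qed.

End gluing.

(** The left-hand side is the constant that [diff2_covering] yields for [r =
    eta / 2]. The factor [6 ^ d] of [c_dim] leaves room for the crude lower
    bound of [unit_ball_volume_ratio]. *)
Lemma c_dim_ge (R : realType) (d : nat) : (2 <= d)%N ->
  8 * d%:R ^+ 2 * (7 / 2) ^+ d <= c_dim R d.
Proof.
case: d => [|[|k]]// _; rewrite /c_dim.
have := @unit_ball_volume_ratio R k.+1; rewrite /=.
set t := unit_ball_volume R k.+2 / _ => tr.
rewrite -[_ * unit_ball_volume R k.+2 / _]mulrA -/t.
have d0 : 0 <= k.+2%:R ^+ 2 :> R by exact: sqr_ge0.
have d3 : 3 <= k.+2%:R + 1 :> R by rewrite natr1 ler_nat.
have H : 8 * (7 / 2) ^+ k.+2 <= 4 * (6 ^+ k.+2 * (6 / 5 * (4 / 5) ^+ k.+1)) :> R.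
  elim: k {t tr d0 d3} => [|k IH]; first by rewrite !exprS !expr0; lra.
  rewrite [(7 / 2) ^+ _]exprS [6 ^+ _]exprS [(4 / 5) ^+ _]exprS.
  move: IH; set A := (7 / 2) ^+ k.+2; set B := 6 ^+ k.+2; set C := (4 / 5) ^+ k.+1.
  have B0 : 0 <= B * C by apply: mulr_ge0 => //; apply: exprn_ge0.
  lra.
have B0 : 0 <= 6 ^+ k.+2 :> R by exact: exprn_ge0.
have h2 : 6 ^+ k.+2 * (6 / 5 * (4 / 5) ^+ k.+1) <= 6 ^+ k.+2 * t :> R.
  by rewrite ler_wpM2l.
have c0 : 0 <= (4 / 5) ^+ k.+1 :> R by apply: exprn_ge0; lra.
have c1 : 0 <= 6 / 5 * (4 / 5) ^+ k.+1 :> R by lra.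
have t0 : 0 <= 6 ^+ k.+2 * t := le_trans (mulr_ge0 B0 c1) h2.
have h3 : 3 * (6 ^+ k.+2 * t) <= (k.+2%:R + 1) * (6 ^+ k.+2 * t) by rewrite ler_wpM2r.
have h4 : 8 * (7 / 2) ^+ k.+2 <= 4 / 3 * ((k.+2%:R + 1) * (6 ^+ k.+2 * t)) by lra.
have : k.+2%:R ^+ 2 * (8 * (7 / 2) ^+ k.+2) <=
   k.+2%:R ^+ 2 * (4 / 3 * ((k.+2%:R + 1) * (6 ^+ k.+2 * t))) by rewrite ler_wpM2l.
congr (_ <= _); ring.
Qed.

(** * The estimate at a fixed scale *)

Section core.
Context {R : realType} {d : nat}.
Local Notation V := 'rV[R]_d.
Hypothesis hd : (2 <= d)%N.
Variables (X Y : set V).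
Hypotheses (cX : compact X) (cY : compact Y).
Variables (M theta : R).
Hypotheses (M0 : 0 < M) (theta0 : 0 < theta).
Variables rho0 mu0 rho1 mu1 : probability V R.
Hypotheses (rho0X : rho0 X = 1%E) (mu0Y : mu0 Y = 1%E).
Hypotheses (rho1X : rho1 X = 1%E) (mu1Y : mu1 Y = 1%E).
Hypothesis hrho0 : forall x (eta : R), 0 < eta ->
  (rho0 (eball x eta) <= (M * eta `^ (d%:R - 1 + theta))%:E)%E.
Local Notation RX := (set_radius X).
Local Notation RY := (set_radius Y).
Local Notation DX := (set_diam X).
Local Notation DY := (set_diam Y).
Let mX := compact_rV_measurable cX.
Let mY := compact_rV_measurable cY.

(** A set of radius 0 is a point, which the growth condition does not allow
    to carry mass. *)
Lemma radius_gt0 : 0 < RX.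
Proof.
rewrite lt_neqAle (radius_ge0 cX rho0X) andbT eq_sym; apply/eqP => RX0.
pose p := d%:R - 1 + theta.
have p0 : 0 < p.
  have : 2 <= d%:R :> R by rewrite ler_nat.
  by rewrite /p; move: theta0; lra.
pose eta := (2 * M)^-1 `^ p^-1.
have M2 : 0 < (2 * M)^-1 by rewrite invr_gt0 mulr_gt0.
have eta0 : 0 < eta by exact: powR_gt0.
have Xb : X `<=` eball 0 eta.
  move=> x Xx; rewrite /eball /= subr0; apply: le_lt_trans eta0.
  by rewrite -RX0 set_radius_ge.
have Xr : (1 <= rho0 (eball 0%R eta))%E.
  by rewrite -rho0X; apply: le_measure; rewrite ?inE//; exact: eball_measurable.
have := le_trans Xr (hrho0 0 eta0); rewrite -/p /eta -powRrM mulVf ?gt_eqF// powRr1 ?(ltW M2)// lee_fin.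
have -> : M * (2 * M)^-1 = 2^-1 by field; rewrite gt_eqF.
by lra.
Qed.

(** Integrate [gap_le_diff2] against [p]. The gaps integrate to the
    differences on the right-hand side, and the second difference is
    dominated by the combination of indicators of [diff2_covering]: the
    integral of each indicator is the mass of a small ball, to which the
    growth condition on [rho0] applies. *)
Lemma gap_estimate (psi : V -> R) (g0 g1 : probability (V * V)%type R) p (eta : R) :
  (forall y y', `|psi y - psi y'| <= RX * enorm (y - y')) ->
  coupling rho0 mu0 g0 -> coupling rho1 mu1 g1 -> coupling g0 g1 p ->
  0 < eta -> eta <= RX ->
  eta * \int[p]_z enorm (z.1.2 - z.2.2) <=
    (\int[rho0]_x potential Y psi x + \int[mu0]_y psi y - \int[g0]_z dotp z.1 z.2)
  + (\int[rho0]_x potential Y psi x + \int[mu1]_y psi y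
       - \int[p]_z dotp z.1.1 z.2.2)
  + c_dim R d * M * RX ^+ d.-1 * DY * eta `^ (1 + theta).
Proof.
move=> psiL g0c g1c pc eta0 etaRX.
have RX0 := radius_gt0; have Y0 := full_nonempty mu0Y.
have DY0 : 0 <= DY := diam_ge0 cY mu0Y.
set phi := potential Y psi.
have phic : is_cvx phi := potential_cvx cY Y0 psiL (ltW RX0).
have phiL := potential_lipschitz cY Y0 psiL (ltW RX0).
have [lo Hlo] : exists lo : 'I_d -> R, forall j x t, 0 <= t ->
    lo j * t <= phi (x + t *: delta_mx ord0 j) - phi x <= (lo j + DY) * t.
  have /boolp.choice[lo Hlo] := fun j => potential_slope cY Y0 psiL (ltW RX0) j.
  by exists lo; exact: Hlo.
pose r := eta / 2.
have r0 : 0 < r by rewrite divr_gt0.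
have rRX : 2 * r <= RX by rewrite /r mulrC divfK.
have [I [z [w [w0 Hw sw]]]] := diff2_covering (ltnW hd) phic Hlo r0 rRX.
pose Psi x := \sum_i w i * \1_(eball (z i) r) x.
have mphi : measurable_fun setT phi := enorm_lipschitz_measurable phiL.
have mpsi : measurable_fun setT psi := enorm_lipschitz_measurable psiL.
have iPsi_ i : integ rho0 (fun x => w i * \1_(eball (z i) r) x).
  by apply: integZ; exact: (expect_indic rho0 (eball_measurable _ _)).1.
have [iPsi PsiE] := expect_sum (index_enum I) iPsi_.
have mPsi : measurable_fun setT Psi.
  apply: measurable_sum => i; apply: measurable_funM => //.
  by apply: measurable_indic; exact: eball_measurable.
have Psi_le : \int[rho0]_x Psi x <= c_dim R d * M * RX ^+ d.-1 * DY * eta `^ (1 + theta).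
  rewrite PsiE; apply: (@le_trans _ _ (\sum_i w i * (M * r `^ (d%:R - 1 + theta)))).
    apply: ler_sum => i _; have [i1 i2] := expect_indic rho0 (eball_measurable (z i) r).
    rewrite expectZ// i2 ler_wpM2l// -lee_fin EFin_prob; last exact: eball_measurable.
    exact: hrho0.
  rewrite -mulr_suml.
  have W0 : 0 <= M * r `^ (d%:R - 1 + theta) by rewrite mulr_ge0 ?powR_ge0// ltW.
  apply: le_trans (ler_wpM2r W0 sw) _.
  have re : r ^+ 2 / r ^+ d * r `^ (d%:R - 1 + theta) = r `^ (1 + theta).
    have rn : r != 0 by rewrite gt_eqF.
    rewrite -!powR_mulrn ?(ltW r0)// -powRB ?rn ?implybT// -powRD ?rn ?implybT//.
    congr (_ `^ _); ring.
  have -> : 16 * d%:R ^+ 2 * DY * (7 / 2) ^+ d * RX ^+ d.-1 * r ^+ 2 / r ^+ d *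
     (M * r `^ (d%:R - 1 + theta)) =
     16 * d%:R ^+ 2 * DY * (7 / 2) ^+ d * RX ^+ d.-1 * M * r `^ (1 + theta).
    by rewrite -re; ring.
  have r2 : r `^ (1 + theta) <= eta `^ (1 + theta) / 2.
    rewrite /r powRM ?invr_ge0 ?(ltW eta0)// ler_wpM2l ?powR_ge0//.
    by apply: ge1r_powR; move: theta0; lra.
  have Q0 : 0 <= DY * RX ^+ d.-1 * M.
    by rewrite !mulr_ge0 ?exprn_ge0 ?(ltW M0) ?(ltW RX0).
  have cd := c_dim_ge R hd.
  have s0 : 0 <= 8 * d%:R ^+ 2 * (7 / 2) ^+ d :> R.
    by rewrite mulr_ge0// ?exprn_ge0// mulr_ge0// sqr_ge0.
  apply: (@le_trans _ _ (8 * d%:R ^+ 2 * (7 / 2) ^+ d * (DY * RX ^+ d.-1 * M)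
      * eta `^ (1 + theta))).
    have := ler_wpM2l (mulr_ge0 s0 Q0) r2.
    rewrite -(@ler_pM2l _ 2)// => h; apply: le_trans (le_trans h _);
      by rewrite le_eqVlt; apply/orP; left; apply/eqP; field.
  have := ler_wpM2r (powR_ge0 eta (1 + theta)) (ler_wpM2r Q0 cd).
  by move/le_trans; apply; rewrite le_eqVlt; apply/orP; left; apply/eqP; ring.
have iphi : integ rho0 phi := integ_lipschitz cX rho0X phiL.
have ipsi0 : integ mu0 psi := integ_lipschitz cY mu0Y psiL.
have ipsi1 : integ mu1 psi := integ_lipschitz cY mu1Y psiL.
have g0b f : measurable_fun setT f -> integ g0 f -> _ := coupling_fst pc (f := f).
have g1b f : measurable_fun setT f -> integ g1 f -> _ := coupling_snd pc (f := f).
have mf1 : measurable_fun setT (@fst V V) := measurable_fst.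
have mf2 : measurable_fun setT (@snd V V) := measurable_snd.
have [a1 a2] := coupling_fst g0c mphi iphi.
have [a3 a4] := g0b _ (measurableT_comp mphi mf1) a1.
have [b1 b2] := coupling_snd g0c mpsi ipsi0.
have [b3 b4] := g0b _ (measurableT_comp mpsi mf2) b1.
have [c1 c2] := coupling_snd g1c mpsi ipsi1.
have [c3 c4] := g1b _ (measurableT_comp mpsi mf2) c1.
have e1 := integ_dotp cX cY rho0X mu0Y g0c.
have [e2 e3] := g0b _ (measurable_dotp mf1 mf2) e1.
have [f1 f2] := coupling_fst g0c mPsi iPsi.
have [f3 f4] := g0b _ (measurableT_comp mPsi mf1) f1.
rewrite /= in a3 a4 b3 b4 c3 c4 e2 e3 f3 f4.
have mXY : measurable (X `*` Y) by exact: measurableX.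
have g0XY := coupling_full g0c mX mY rho0X mu0Y.
have g1XY := coupling_full g1c mX mY rho1X mu1Y.
have mA : measurable ((X `*` Y) `*` (X `*` Y)) by exact: measurableX.
have pA := coupling_full pc mXY mXY g0XY g1XY.
have k1 : integ p (fun z => dotp z.1.1 z.2.2).
  apply: (integ_bounded mA pA (C := RX * RY)).
    by apply: measurable_dotp; exact: measurableT_comp.
  by move=> u [[? _] [_ ?]]; exact: dotp_bound.
have k2 : integ p (fun z => enorm (z.1.2 - z.2.2)).
  apply: (integ_bounded mA pA (C := DY)).
    by apply: measurable_enormB; exact: measurableT_comp.
  by move=> u [[_ ?] [_ ?]]; rewrite ger0_norm ?enorm_ge0// set_diam_ge.
have main : eta * \int[p]_z enorm (z.1.2 - z.2.2) <=
  \int[p]_u ((phi u.1.1 + psi u.1.2 - dotp u.1.1 u.1.2)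
      + (phi u.1.1 + psi u.2.2 - dotp u.1.1 u.2.2) + Psi u.1.1).
  rewrite -expectZ//; apply: (le_expect mA pA).
  - exact: integZ.
  - by repeat (first [apply: integB | apply: integD]).
  - move=> u [[X1 Y1] [X2 Y2]].
    have [v ve] := gap_le_diff2 cY Y0 psiL (ltW RX0) u.1.1 eta0 Y1 Y2.
    move=> /le_trans; apply; rewrite lerD2l.
    have ve' : enorm v <= 2 * r by rewrite /r mulrC divfK.
    have := Hw _ _ (set_radius_ge cX X1) ve' => /le_trans; apply.
    rewrite le_eqVlt; apply/orP; left; apply/eqP; apply: eq_bigr => i _.
    congr (_ * _); rewrite indicE enormB; congr (_%:R); congr nat_of_bool.
    by apply/idP/idP => [h|/set_mem//]; exact: mem_set.
apply: le_trans main _.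
rewrite expectD; [|by repeat (first [apply: integB | apply: integD])|exact: f3].
rewrite expectD; [|by repeat (first [apply: integB | apply: integD])..].
rewrite expectB; [|exact: integD|by []].
rewrite expectD//.
rewrite expectB; [|exact: integD|by []].
rewrite expectD//.
rewrite a4 a2 b4 b2 c4 c2 e3 f4 f2.
by apply: lerD.
Qed.

(** For [t = (e / (DY * RX)) `^ (1 + theta)^-1] and the scale [RX * t] the
    two terms are both multiples of [t `^ theta]. If [t >= 1] that scale is
    too large, but then the bound [b <= DY] suffices. *)
Lemma optimize_scale (b e k : R) : 0 <= b <= DY -> 0 < e -> 0 <= k ->
  (forall eta, 0 < eta -> eta <= RX ->
     eta * b <= e + k * RX ^+ d.-1 * DY * eta `^ (1 + theta)) ->
  b <= DY * (1 + k * RX `^ (d%:R - 1 + theta)) *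
       (e / (DY * RX)) `^ (theta / (1 + theta)).
Proof.
move=> /andP[b0 bD] e0 k0 H.
have RX0 := radius_gt0.
have [D0|D0] := eqVneq DY 0; first by rewrite D0 !mul0r -D0.
have {D0} DY0 : 0 < DY by rewrite lt_neqAle eq_sym D0 (le_trans b0 bD).
have th1 : 0 < 1 + theta by move: theta0; lra.
set s := e / (DY * RX).
have s0 : 0 < s by rewrite divr_gt0// mulr_gt0.
have K0 : 0 <= k * RX `^ (d%:R - 1 + theta) by rewrite mulr_ge0 ?powR_ge0.
have [s1|s1] := leP 1 s.
  apply: le_trans bD _; rewrite -mulrA ler_peMr ?(ltW DY0)//.
  rewrite -[leLHS]mul1r; apply: ler_pM => //; first by rewrite lerDl.
  by rewrite -[leLHS](powRr0 s) ler_powR// divr_ge0 ?(ltW th1) ?(ltW theta0).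
pose t := s `^ (1 + theta)^-1.
have t0 : 0 < t by exact: powR_gt0.
have t1 : t <= 1.
  by rewrite /t -[leRHS](powRr0 s) ger_powR ?s0 ?(ltW s1)// invr_ge0 (ltW th1).
have tE : s = t * t `^ theta.
  rewrite -{1}(powRr1 (ltW t0)) -powRD ?(gt_eqF t0) ?implybT//.
  by rewrite -powRrM mulVf ?gt_eqF// powRr1// (ltW s0).
have tT : s `^ (theta / (1 + theta)) = t `^ theta by rewrite mulrC powRrM.
have eE : e = DY * RX * (t * t `^ theta).
  by rewrite -tE /s; field; rewrite !gt_eqF.
have eta0 : 0 < RX * t by rewrite mulr_gt0.
have := H (RX * t) eta0; rewrite ger_pMr// => /(_ t1).
have -> : RX `^ (d%:R - 1 + theta) = RX ^+ d.-1 * RX `^ theta.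
  rewrite powRD ?(gt_eqF RX0) ?implybT//; congr (_ * _).
  by rewrite -powR_mulrn ?(ltW RX0)//; congr (_ `^ _); rewrite -[in LHS](prednK (ltnW hd)) -natr1 addrK.
have -> : (RX * t) `^ (1 + theta) = (RX * t) * (RX `^ theta * t `^ theta).
  rewrite powRD ?(gt_eqF eta0) ?implybT// powRr1 ?(ltW eta0)//.
  by rewrite powRM ?(ltW RX0) ?(ltW t0).
rewrite tT {1}eE => h; rewrite -(ler_pM2l eta0); apply: le_trans h _.
rewrite le_eqVlt; apply/orP; left; apply/eqP; ring.
Qed.

End core.

(** * Stability *)

Section wasserstein.
Context {R : realType} {n : nat}.
Local Notation V := 'rV[R]_n.
Variables (X : set V) (rho0 rho1 : probability V R).
Hypotheses (cX : compact X) (rho0X : rho0 X = 1%E) (rho1X : rho1 X = 1%E).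

Lemma wass1_near_optimal : exists w : R, [/\ 0 <= w, wass1 rho0 rho1 = w%:E &
  forall e, 0 < e -> exists2 s, coupling rho0 rho1 s &
    \int[s]_z enorm (z.1 - z.2) <= w + e].
Proof.
have E s : coupling rho0 rho1 s ->
    (\int[s]_z (enorm (z.1 - z.2))%:E)%E = (\int[s]_z enorm (z.1 - z.2))%:E.
  by move=> sc; rewrite EFin_expect//; exact: (integ_dist cX rho0X rho1X sc).
set S := [set (\int[g]_z ((enorm (z.1 - z.2))%:E))%E | g in coupling rho0 rho1].
have S0 : (0 <= ereal_inf S)%E.
  apply: le_ereal_inf_tmp => _ [s sc <-]; apply: integral_ge0 => z _.
  by rewrite lee_fin enorm_ge0.
have [s0 s0c] := product_coupling rho0 rho1.
have Sfin : ereal_inf S \is a fin_num.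
  rewrite ge0_fin_numE//; apply: le_lt_trans (ltry (\int[s0]_z enorm (z.1 - z.2))).
  by rewrite -E//; apply: ereal_inf_lbound; exists s0.
exists (fine (ereal_inf S)); split; first exact: fine_ge0.
  by rewrite fineK.
move=> e e0; have [_ [s sc <-] sS] := lb_ereal_inf_adherent e0 Sfin.
exists s => //; rewrite -lee_fin -E// EFinD fineK//; exact: ltW.
Qed.

(** The easy half of the Kantorovich-Rubinstein duality. *)
Lemma lipschitz_expect_le (psi : V -> R) (L : R) s :
  (forall y y', `|psi y - psi y'| <= L * enorm (y - y')) -> coupling rho0 rho1 s ->
  \int[rho1]_y psi y <= \int[rho0]_y psi y + L * \int[s]_z enorm (z.1 - z.2).
Proof.
move=> psiL sc; have mX := compact_rV_measurable cX.
have mpsi := enorm_lipschitz_measurable psiL.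
have [i1 <-] := coupling_snd sc mpsi (integ_lipschitz cX rho1X psiL).
have [i0 <-] := coupling_fst sc mpsi (integ_lipschitz cX rho0X psiL).
have id_ := integ_dist cX rho0X rho1X sc.
rewrite -expectZ// -expectD//; last exact: integZ.
have mXX : measurable (X `*` X) by exact: measurableX.
apply: (le_expect mXX (coupling_full sc mX mX rho0X rho1X)) => //.
  by apply: integD => //; exact: integZ.
move=> z _; have := psiL z.1 z.2; rewrite ler_norml; lra.
Qed.

End wasserstein.

Section power.
Context {R : realType}.
Implicit Types (q s D : R).

Lemma powR_le_linear q s D : 1 <= q -> 0 <= s <= D -> s `^ q <= D `^ (q - 1) * s.
Proof.
move=> q1 /andP[s0 sD].
rewrite -(mulr_powRB1 s0); last by lra.
rewrite mulrC ler_wpM2r// ge0_ler_powR ?nnegrE//; first lra.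
exact: le_trans sD.
Qed.

(** Write [a] as the product of its powers of exponents [1 / (1 + theta)]
    and [theta / (1 + theta)], and use one bound for each factor. *)
Lemma le_interpolate (a D e r theta : R) : 0 < theta -> 0 <= a -> a <= D ->
  0 < r -> r * a <= e ->
  a <= D `^ (1 + theta)^-1 * (r `^ (- (theta / (1 + theta)))
         * e `^ (theta / (1 + theta))).
Proof.
move=> th0 a0 aD r0 rae.
have th1 : 0 < 1 + theta by lra.
have u0 : 0 <= (1 + theta)^-1 by rewrite invr_ge0 ltW.
have v0 : 0 <= theta / (1 + theta) by rewrite divr_ge0 ?(ltW th0) ?(ltW th1).
have uv : (1 + theta)^-1 + theta / (1 + theta) = 1 by field; rewrite gt_eqF.
have e0 : 0 <= e by apply: le_trans rae; rewrite mulr_ge0// ltW.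
rewrite -{1}(powRr1 a0) -{1}uv powRD; last by rewrite uv oner_eq0.
apply: ler_pM; rewrite ?powR_ge0//.
  by rewrite ge0_ler_powR ?nnegrE// (le_trans a0).
rewrite powRN [leRHS]mulrC ler_pdivlMr ?powR_gt0// -powRM// ?(ltW r0)//.
have ar : a * r <= e by rewrite mulrC.
by apply: ge0_ler_powR => //; rewrite nnegrE// mulr_ge0// ltW.
Qed.

(** Right continuity of a positive power, in the form needed to let an error
    term tend to zero. *)
Lemma powR_le_limit (x : \bar R) (c eps L s : R) : 0 < s -> 0 <= c -> 0 <= eps ->
  0 <= L ->
  (forall del, 0 < del -> (x <= (c * (eps + L * del) `^ s)%:E)%E) ->
  (x <= (c * eps `^ s)%:E)%E.
Proof.
move=> s0 c0 eps0 L0 H; apply/lee_addgt0Pr => nu nu0.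
have c1 : 0 < c + 1 by lra.
pose y := eps `^ s + nu / (c + 1).
have yp : eps `^ s < y by rewrite ltrDl divr_gt0.
have y0 : 0 <= y by apply: le_trans (ltW yp); exact: powR_ge0.
have ey : eps < y `^ s^-1.
  have : (eps `^ s) `^ s^-1 < y `^ s^-1.
    by rewrite gt0_ltr_powR ?nnegrE ?invr_gt0 ?powR_ge0.
  by rewrite -powRrM mulfV ?gt_eqF// powRr1.
pose del := (y `^ s^-1 - eps) / (L + 1).
have L1 : 0 < L + 1 by lra.
have del0 : 0 < del by rewrite divr_gt0// subr_gt0.
apply: le_trans (H del del0) _; rewrite -EFinD lee_fin.
apply: (@le_trans _ _ (c * y)).
  rewrite ler_wpM2l//.
  have Ld : eps + L * del <= y `^ s^-1.
    have : L * del <= (L + 1) * del by rewrite ler_wpM2r ?(ltW del0)// lerDl.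
    have -> : (L + 1) * del = y `^ s^-1 - eps by rewrite /del mulrC divfK// gt_eqF.
    lra.
  apply: (@le_trans _ _ ((y `^ s^-1) `^ s)).
    rewrite ge0_ler_powR ?nnegrE ?powR_ge0 ?(ltW s0)//.
    by rewrite addr_ge0// mulr_ge0// ltW.
  by rewrite -powRrM mulVf ?gt_eqF// powRr1.
rewrite /y mulrDr lerD2l mulrCA ger_pMr//.
by rewrite ler_pdivrMr// mul1r; lra.
Qed.

End power.

Section stability.
Context {R : realType} {d : nat}.
Local Notation V := 'rV[R]_d.
Hypothesis hd : (2 <= d)%N.
Variables (X Y : set V) (q M theta : R).
Hypotheses (cX : compact X) (cY : compact Y).
Hypotheses (q1 : 1 <= q) (M0 : 0 < M) (theta0 : 0 < theta).
Variables rho0 mu0 rho1 mu1 : probability V R.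
Hypotheses (rho0X : rho0 X = 1%E) (mu0Y : mu0 Y = 1%E).
Hypotheses (rho1X : rho1 X = 1%E) (mu1Y : mu1 Y = 1%E).
Hypothesis hrho0 : forall x (eta : R), 0 < eta ->
  (rho0 (eball x eta) <= (M * eta `^ (d%:R - 1 + theta))%:E)%E.
Variables g0 g1 : probability (V * V)%type R.
Hypotheses (g0opt : optimal_plan rho0 mu0 g0) (g1c : coupling rho1 mu1 g1).
Hypothesis RY0 : 0 < set_radius Y.
Local Notation RX := (set_radius X).
Local Notation RY := (set_radius Y).
Local Notation DX := (set_diam X).
Local Notation DY := (set_diam Y).
Let mX := compact_rV_measurable cX.
Let mY := compact_rV_measurable cY.
Let g0c : coupling rho0 mu0 g0 := g0opt.1.
Let RX0 : 0 < RX := radius_gt0 hd cX M0 theta0 rho0X hrho0.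
Let DX0 : 0 <= DX := diam_ge0 cX rho0X.
Let DY0 : 0 <= DY := diam_ge0 cY mu0Y.
Let mXY : measurable (X `*` Y). Proof. exact: measurableX. Qed.
Let mA : measurable ((X `*` Y) `*` (X `*` Y)). Proof. exact: measurableX. Qed.
Let g0XY : g0 (X `*` Y) = 1%E. Proof. exact: (coupling_full g0c). Qed.
Let g1XY : g1 (X `*` Y) = 1%E. Proof. exact: (coupling_full g1c). Qed.

Section plan.
Variable p : probability ((V * V) * (V * V))%type R.
Hypothesis pc : coupling g0 g1 p.
Let pA : p ((X `*` Y) `*` (X `*` Y)) = 1%E.
Proof. exact: (coupling_full pc). Qed.
Local Notation dx := (\int[p]_z enorm (z.1.1 - z.2.1)).
Local Notation dy := (\int[p]_z enorm (z.1.2 - z.2.2)).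

Let ix : integ p (fun z => enorm (z.1.1 - z.2.1)).
Proof.
apply: (integ_bounded mA pA (C := DX)).
  by apply: measurable_enormB; exact: (measurableT_comp measurable_fst).
by move=> u [[? _] [? _]]; rewrite ger0_norm ?enorm_ge0// set_diam_ge.
Qed.

Let iy : integ p (fun z => enorm (z.1.2 - z.2.2)).
Proof.
apply: (integ_bounded mA pA (C := DY)).
  by apply: measurable_enormB; exact: (measurableT_comp measurable_snd).
by move=> u [[_ ?] [_ ?]]; rewrite ger0_norm ?enorm_ge0// set_diam_ge.
Qed.

Lemma plan_dist_bounds : 0 <= dx <= DX /\ 0 <= dy <= DY.
Proof.
split; apply/andP; split.
- by apply: Rintegral_ge0 => z _; exact: enorm_ge0.
- rewrite -(expect_cst p DX); apply: (le_expect mA pA) => //; first exact: integ_cst.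
  by move=> u [[? _] [? _]]; exact: set_diam_ge.
- by apply: Rintegral_ge0 => z _; exact: enorm_ge0.
- rewrite -(expect_cst p DY); apply: (le_expect mA pA) => //; first exact: integ_cst.
  by move=> u [[_ ?] [_ ?]]; exact: set_diam_ge.
Qed.

Lemma plan_cost_le :
  (\int[p]_z ((enorm (z.1.1 - z.2.1) `^ q + enorm (z.1.2 - z.2.2) `^ q)%:E) <=
   (DX `^ (q - 1) * dx + DY `^ (q - 1) * dy)%:E)%E.
Proof.
have ic : integ p (fun z => enorm (z.1.1 - z.2.1) `^ q + enorm (z.1.2 - z.2.2) `^ q).
  apply: (integ_bounded mA pA (C := DX `^ q + DY `^ q)).
    apply: measurable_funD; apply: (measurableT_comp (measurable_powR _));
      apply: measurable_enormB;
      by [exact: (measurableT_comp measurable_fst)|exact: (measurableT_comp measurable_snd)].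
  move=> u [[X1 Y1] [X2 Y2]]; rewrite ger0_norm ?addr_ge0 ?powR_ge0//.
  have q0 : 0 <= q by move: q1; lra.
  by apply: lerD; rewrite ge0_ler_powR ?nnegrE ?enorm_ge0 ?set_diam_ge.
rewrite -EFin_expect// lee_fin -!expectZ// -expectD; [|exact: integZ..].
apply: (le_expect mA pA) => //; first by apply: integD; exact: integZ.
move=> u [[X1 Y1] [X2 Y2]].
by apply: lerD; apply: powR_le_linear; rewrite // enorm_ge0 set_diam_ge.
Qed.

(** Replacing the source of the second plan by that of the first costs the
    distance of the sources times the norm of the target. *)
Lemma mixed_dotp_ge :
  \int[g1]_z dotp z.1 z.2 - RY * dx <= \int[p]_z dotp z.1.1 z.2.2.
Proof.
have mf1 : measurable_fun setT (@fst V V) := measurable_fst.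
have mf2 : measurable_fun setT (@snd V V) := measurable_snd.
have e1 := integ_dotp cX cY rho1X mu1Y g1c.
have [e2 <-] := coupling_snd pc (measurable_dotp mf1 mf2) e1.
rewrite -expectZ// -expectB//; last exact: integZ.
apply: (le_expect mA pA).
- by apply: integB => //; exact: integZ.
- apply: (integ_bounded mA pA (C := RX * RY)).
    by apply: measurable_dotp; exact: measurableT_comp.
  by move=> u [[? _] [_ ?]]; exact: dotp_bound.
move=> u [[X1 Y1] [X2 Y2]].
have := norm_dotp_le (u.1.1 - u.2.1) u.2.2; rewrite dotpBl ler_norml.
have : enorm (u.1.1 - u.2.1) * enorm u.2.2 <= RY * enorm (u.1.1 - u.2.1).
  by rewrite mulrC ler_wpM2r ?enorm_ge0// set_radius_ge.
lra.
Qed.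

End plan.

Lemma constq_ge0 : 0 <= constq q M theta X Y.
Proof.
rewrite /constq addr_ge0// ?mulr_ge0 ?powR_ge0//.
rewrite addr_ge0// mulr_ge0 ?powR_ge0// mulr_ge0 ?(ltW M0)//.
by apply: le_trans (c_dim_ge R hd); rewrite !mulr_ge0 ?exprn_ge0// divr_ge0.
Qed.

(** The cost of the glued plan [p] splits into the displacements of the
    sources and of the targets. The sources are close by the choice of [p].
    For the targets, the integrated gaps of the almost optimal potential add
    up to at most [e]: the gap of the first plan is at most [del] by
    [approximate_duality], and passing to the mixed pairs of a source of the
    first plan and a target of the second changes it by the difference of
    the two plans' correlations and by the distances between marginals. *)
Lemma plan_exists (w0 w1 del : R) :
  (exists2 s, coupling rho0 rho1 s & \int[s]_z enorm (z.1 - z.2) <= w0 + del) ->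
  (exists2 s, coupling mu0 mu1 s & \int[s]_z enorm (z.1 - z.2) <= w1 + del) ->
  0 <= w0 -> 0 <= w1 -> 0 < del ->
  let eps := `|\int[g0]_z dotp z.1 z.2 - \int[g1]_z dotp z.1 z.2|
             + RY * w0 + RX * w1 in
  exists2 p, coupling g0 g1 p &
  (\int[p]_z ((enorm (z.1.1 - z.2.1) `^ q + enorm (z.1.2 - z.2.2) `^ q)%:E) <=
   (constq q M theta X Y
     * (eps + (2 + 2 * RY + RX) * del) `^ (theta / (1 + theta)))%:E)%E.
Proof.
move=> [s sc sw] [s' s'c s'w] w00 w10 del0 eps.
have [p pc pdx] := approximate_gluing cX rho0X rho1X g0c g1c sc del0.
exists p => //; apply: le_trans (plan_cost_le pc) _; rewrite lee_fin.
have [/andP[dx0 dxD] dyb] := plan_dist_bounds pc.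
set dx := \int[p]_z enorm (z.1.1 - z.2.1) in pdx dx0 dxD *.
set dy := \int[p]_z enorm (z.1.2 - z.2.2) in dyb *.
have dy0 : 0 <= dy by case/andP: dyb.
set e := eps + _.
have RYdx : RY * dx <= RY * w0 + 2 * RY * del.
  have : RY * dx <= RY * (w0 + del + del).
    by rewrite ler_pM2l//; apply: le_trans pdx _; rewrite lerD2r.
  lra.
have RXs : RX * \int[s']_z enorm (z.1 - z.2) <= RX * w1 + RX * del.
  by rewrite -mulrDr ler_pM2l.
have RXdel : 0 <= RX * del by rewrite mulr_ge0 ?(ltW RX0) ?(ltW del0).
have RYdel : 0 <= RY * del by rewrite mulr_ge0 ?(ltW RY0) ?(ltW del0).
have RXw : 0 <= RX * w1 by rewrite mulr_ge0 ?(ltW RX0).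
have RYw : 0 <= RY * w0 by rewrite mulr_ge0 ?(ltW RY0).
have n0 := ler_norm (\int[g0]_z dotp z.1 z.2 - \int[g1]_z dotp z.1 z.2).
have n1 := normr_ge0 (\int[g0]_z dotp z.1 z.2 - \int[g1]_z dotp z.1 z.2).
have L0 : 0 < 2 + 2 * RY + RX by rewrite addr_gt0// addr_gt0// mulr_gt0.
have eps0 : 0 <= eps by rewrite /eps !addr_ge0.
have e0 : 0 < e by rewrite /e ltr_wpDl// mulr_gt0.
have dxe : RY * dx <= e by rewrite /e /eps; lra.
have [psi [psiL psiT]] := approximate_duality cX cY rho0X mu0Y g0opt del0.
have c0 : 0 <= c_dim R d * M.
  rewrite mulr_ge0 ?(ltW M0)//; apply: le_trans (c_dim_ge R hd).
  by rewrite !mulr_ge0 ?exprn_ge0// divr_ge0.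
have dyH eta : 0 < eta -> eta <= RX ->
    eta * dy <= e + c_dim R d * M * RX ^+ d.-1 * DY * eta `^ (1 + theta).
  move=> eta0 etaX.
  apply: le_trans (gap_estimate hd cX cY M0 theta0 rho0X mu0Y rho1X mu1Y hrho0
    psiL g0c g1c pc eta0 etaX) _.
  rewrite lerD2r.
  have := mixed_dotp_ge pc; rewrite -/dx => h1.
  have h2 := lipschitz_expect_le cY mu0Y mu1Y psiL s'c.
  rewrite /e /eps; lra.
have := optimize_scale hd cX M0 theta0 rho0X hrho0 dyb e0 c0 dyH.
set K := 1 + _; set t := theta / (1 + theta) => dyK.
have K0 : 0 <= K by rewrite addr_ge0// mulr_ge0// powR_ge0.
have dxK := le_interpolate theta0 dx0 dxD RY0 dxe; rewrite -/t in dxK.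
rewrite /constq -/t -/K mulrDl; apply: lerD.
  apply: le_trans (ler_wpM2l (powR_ge0 _ _) dxK) _.
  have th1 : 0 < (1 + theta)^-1 by rewrite invr_gt0 addr_gt0.
  rewrite (@powRD _ DX (q - 1)); last first.
    by rewrite implybE; apply/orP; left; rewrite gt_eqF// ltr_wpDl// subr_ge0.
  by rewrite le_eqVlt; apply/orP; left; apply/eqP; ring.
apply: le_trans (ler_wpM2l (powR_ge0 _ _) dyK) _.
rewrite -(@mulr_powRB1 _ DY q DY0); last by move: q1; lra.
have -> : (e / (DY * RX)) `^ t = e `^ t * (DY * RX) `^ (- t).
  have D0 : 0 <= DY * RX := mulr_ge0 DY0 (ltW RX0).
  have D1 : 0 <= (DY * RX)^-1 by rewrite invr_ge0.
  rewrite (powRM _ (ltW e0) D1); congr (_ * _).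
  by rewrite -powR_inv1// -powRrM mulN1r.
by rewrite le_eqVlt; apply/orP; left; apply/eqP; ring.
Qed.

End stability.

Unset Implicit Arguments.

Theorem theorem4p2 (R : realType) (d : nat) (hd : (2 <= d)%N)
  (q : R) (hq : 1 <= q)
  (X Y : set 'rV[R]_d)
  (cX : compact X) (cY : compact Y)
  (vX : convex_set (X : set (convex_lmodType 'rV[R]_d)))
  (vY : convex_set (Y : set (convex_lmodType 'rV[R]_d)))
  (M : R) (hM : 0 < M) (theta : R) (ht0 : 0 < theta) (ht1 : theta <= 1)
  (rho0 : probability 'rV[R]_d R) (rho0X : rho0 X = 1%E)
  (hrho0 : forall (x : 'rV[R]_d) (eta : R), 0 < eta ->
     (rho0 (eball x eta) <= (M * eta `^ (d%:R - 1 + theta))%:E)%E)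
  (mu0 : probability 'rV[R]_d R) (mu0Y : mu0 Y = 1%E)
  (gamma0 : probability ('rV[R]_d * 'rV[R]_d)%type R)
  (hgamma0 : optimal_plan rho0 mu0 gamma0)
  (rho1 : probability 'rV[R]_d R) (rho1X : rho1 X = 1%E)
  (mu1 : probability 'rV[R]_d R) (mu1Y : mu1 Y = 1%E)
  (gamma1 : probability ('rV[R]_d * 'rV[R]_d)%type R)
  (hgamma1 : coupling rho1 mu1 gamma1)
  (hRY : 0 < set_radius Y) :
  (wass_plan q gamma0 gamma1 <=
   (constq q M theta X Y `^ q^-1)%:E *
   poweR (`| \int[gamma0]_(z in X `*` Y) dotp z.1 z.2
            - \int[gamma1]_(z in X `*` Y) dotp z.1 z.2 |%R%:E
          + (set_radius Y)%:E * wass1 rho0 rho1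
          + (set_radius X)%:E * wass1 mu0 mu1)
     (theta / (q * (1 + theta))))%E.
Proof.
have RX0 := radius_gt0 hd cX hM ht0 rho0X hrho0.
have g0c := hgamma0.1.
have mXY : measurable (X `*` Y).
  by apply: measurableX; exact: compact_rV_measurable.
have th1 : 0 < 1 + theta by lra.
have q0 : 0 < q by lra.
set t := theta / (1 + theta).
have t0 : 0 < t by rewrite divr_gt0.
rewrite (expect_on_full mXY _ (integ_dotp cX cY rho0X mu0Y g0c)); last first.
  by apply: (coupling_full g0c) => //; exact: compact_rV_measurable.
rewrite (expect_on_full mXY _ (integ_dotp cX cY rho1X mu1Y hgamma1)); last first.
  by apply: (coupling_full hgamma1) => //; exact: compact_rV_measurable.
have [w0 [w00 -> Hw0]] := wass1_near_optimal cX rho0X rho1X.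
have [w1 [w10 -> Hw1]] := wass1_near_optimal cY mu0Y mu1Y.
rewrite -!EFinM.
set eps := _ + _ + _.
have eps0 : 0 <= eps by rewrite !addr_ge0// mulr_ge0// ltW.
have C0 : 0 <= constq q M theta X Y by exact: constq_ge0.
have L0 : 0 <= 2 + 2 * set_radius Y + set_radius X by move: (RX0) (hRY); lra.
rewrite /wass_plan; set W := ereal_inf _.
have W0 : (0 <= W)%E.
  apply: le_ereal_inf_tmp => _ [p pc <-]; apply: integral_ge0 => z _.
  by rewrite lee_fin addr_ge0// powR_ge0.
have WC : (W <= (constq q M theta X Y * eps `^ t)%:E)%E.
  apply: (powR_le_limit t0 C0 eps0 L0) => del del0.
  have [p pc pW] := plan_exists hd cX cY hq hM ht0 rho0X mu0Y rho1X mu1Y hrho0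
    hgamma0 hgamma1 hRY (Hw0 _ del0) (Hw1 _ del0) w00 w10 del0.
  by apply: le_trans pW; apply: ereal_inf_lbound; exists p.
have -> : theta / (q * (1 + theta)) = t * q^-1.
  by rewrite /t; field; rewrite !gt_eqF.
rewrite powRrM -powRM ?powR_ge0// -poweR_EFin.
apply: gt0_ler_poweR => //; first by rewrite invr_ge0 ltW.
- by rewrite in_itv/= W0 leey.
- by rewrite in_itv/= leey andbT lee_fin mulr_ge0// powR_ge0.
Qed.
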